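(* Let $m,n,p\geq 1$ and let $\alpha_1,\ldots,\alpha_p\geq 0$ with $\alpha_1+\cdots+\alpha_p=1$. Let $R^1,\ldots,R^p\in{\mathbb Z}_{\geq 0}^m$ and $C^1,\ldots,C^p\in{\mathbb Z}_{\geq 0}^n$ satisfy $|R^1|=\cdots=|R^p|=|C^1|=\cdots=|C^p|=N$. Let $K=(k_{ij})\in{\mathbb Z}_{\geq 0}^{m\times n}$. Define $$R:=\alpha_1R^1+\cdots+\alpha_pR^p,\qquad C:=\alpha_1C^1+\cdots+\alpha_pC^p,$$ and define vectors $\tilde C^1,\ldots,\tilde C^p,\tilde C$ by $$\tilde c^t_j := \Big(\sum_{i=1}^m k_{ij}\Big) - c^t_j\quad(1\leq t\leq p,\ 1\leq j\leq n),\qquad \tilde c_j := \Big(\sum_{i=1}^m k_{ij}\Big) - c_j = \alpha_1\tilde c^1_j+\cdots+\alpha_p\tilde c^p_j .$$ Assume $c^t_j\leq \sum_{i=1}^m k_{ij}$ for all $t,j$ (so $\tilde C^t\in{\mathbb Z}_{\geq 0}^n$), and assume $R$ and $C$ have integer entries (so $\Omega(R)$ and $\Omega(\tilde C)$ are defined). Then $$\frac{\omega(|K|)\,T_K(R,C)}{\Omega(R)\,\Omega(\tilde C)\,\Omega(K)} \;\geq\; \prod_{t=1}^p \left[\frac{T_K(R^t,C^t)}{\min\{\Omega(R^t)\Omega(\tilde C^t),\ \Omega(K)\}}\right]^{\alpha_t}.$$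
   Context: For a vector or matrix $V$, $|V|$ denotes the sum of its entries; coordinates of a vector named by an uppercase letter are denoted by the corresponding lowercase letter (e.g. $R=(r_1,\ldots,r_m)$, $\tilde C^t=(\tilde c^t_1,\ldots,\tilde c^t_n)$). For an integer $n\geq 0$, $\omega(n):=n^n/n!$ with $0^0=1$. For a vector or matrix $V$ with nonnegative integer entries, $\Omega(V)$ is the sum of $\omega(v)$ over all entries $v$ of $V$. For $R\in{\mathbb Z}_{\geq 0}^m$, $C\in{\mathbb Z}_{\geq 0}^n$ and $K\in{\mathbb Z}_{\geq 0}^{m\times n}$, $T_K(R,C)$ is the number of nonnegative integer $m\times n$ matrices $A=(a_{ij})$ with row sums $\sum_j a_{ij}=r_i$, column sums $\sum_i a_{ij}=c_j$, and $a_{ij}\leq k_{ij}$ for all $i,j$.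
   Formalization: Ω(V) is taken as the product, not the sum, of ω(v) over the entries of V; with the sum the inequality fails, e.g. for m=n=2, p=1, K, R, C all zero (left side 1/16, right side 1/4). *)

(* Defs.v *)
(* MathComp / MathComp-Analysis development. *)
From HB Require Import structures.
From mathcomp Require Import all_boot all_order all_algebra.
From mathcomp Require Import finmap.
From mathcomp Require Import all_classical all_reals all_analysis.

Set Implicit Arguments.
Unset Strict Implicit.
Unset Printing Implicit Defensive.

Import Order.TTheory GRing.Theory Num.Theory.
Local Open Scope ring_scope.

Definition mxsum (m n : nat) (V : 'M[nat]_(m, n)) : nat :=
  (\sum_i \sum_j V i j)%N.

(* omega 0 = 1, since 0 ^+ 0 = 1. *)
Definition omega (F : realType) (n : nat) : F := n%:R ^+ n / (n`!)%:R.

(* Omega is multiplicative: the PRODUCT of omega over all entries, so that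
   Omega of the concatenation of two vectors is the product of their Omegas.
   With a sum in place of this product, the inequality for bounded tables would
   already fail for m = n = 2, p = 1 and K = 0. *)
Definition Omega (F : realType) (m n : nat) (V : 'M[nat]_(m, n)) : F :=
  \prod_i \prod_j omega F (V i j).

Definition tables (m n : nat) (K : 'M[nat]_(m, n))
    (R : 'rV[nat]_m) (C : 'rV[nat]_n) : set 'M[nat]_(m, n) :=
  [set A | [/\ forall i, (\sum_j A i j)%N = R 0 i,
               forall j, (\sum_i A i j)%N = C 0 j
             & forall i j, (A i j <= K i j)%N]]%classic.

(* [fset_set] sends infinite sets to the empty one; this rules that case out. *)
Lemma finite_tables (m n : nat) (K : 'M[nat]_(m, n))
    (R : 'rV[nat]_m) (C : 'rV[nat]_n) : finite_set (tables K R C).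
Proof.
pose b := mxsum K.
pose f (B : 'M['I_b.+1]_(m, n)) : 'M[nat]_(m, n) := map_mx (@nat_of_ord _) B.
apply: (@sub_finite_set _ _ (f @` setT)%classic); last first.
  exact/finite_image/finite_finset.
move=> A [_ _ hA]; exists (map_mx inord A) => //.
apply/matrixP => i j; rewrite !mxE inordK // ltnS (leq_trans (hA i j)) //.
by rewrite /b /mxsum (bigD1 i) //= (bigD1 j) //= -addnA leq_addr.
Qed.

Definition T (m n : nat) (K : 'M[nat]_(m, n))
    (R : 'rV[nat]_m) (C : 'rV[nat]_n) : nat := #|` fset_set (tables K R C)|.

(* The subtraction is truncated, hence meaningful only when C is bounded by
   the column sums of K. *)
Definition compl_col (m n : nat) (K : 'M[nat]_(m, n)) (C : 'rV[nat]_n) :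
    'rV[nat]_n :=
  \row_j ((\sum_i K i j) - C 0%R j)%N.

(* Main.v *)
(** Bounded tables become tables with prescribed support: a table A <= K and its
    complement K - A form an (m + n) x (m * n) table with row sums (R, compl_col K C)
    and column sums K, whose columns each have only two admissible cells.  Give the
    admissible cells weight 1, the other ones weight eps, and let eps tend to 0 at the end.

    For positive weights w, with row sums r, column sums c and total N, the weighted number
    of tables is the integral of q_r(g) exp(- |g|) over positive matrices g, where q_r(g)
    is the coefficient of x^r in f_g(x) = prod_j (sum_i w_ij g_ij x_i)^c_j / c_j!, because
    the integral of g^a exp(- g) is a!.  By the Prekopa-Leindler inequality it is enough
    to prove the pointwise inequality between the coefficients q.  Since g |-> f_g(x) is
    log-concave, that inequality follows by comparing q_r(g) with the infimum kappa of
    f_g(x) / x^r over x > 0: on the one side q_r(g) is at most kappa (discard the row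
    constraints) and at most kappa * Omega(r) / Omega(c) (rescale the columns, discard the
    column constraints and apply Gibbs' inequality); on the other side
    q_r(g) >= kappa * Omega(r) / omega(N), which is Gurvits' form of the van der Waerden
    bound, proved by extracting the coefficient one variable at a time from a polynomial
    without zeros in the right half-space.

    All functions to be integrated are polynomials, so integration is the linear functional
    sending x^k to k!, and the one-dimensional Prekopa-Leindler inequality is proved by
    transport through explicit primitives. *)

Require Import Defs.
From mathcomp Require Import all_boot all_order all_algebra finmap ring lra zify.
From mathcomp Require Import all_classical all_reals all_analysis.
From mathcomp Require Import complex.
Import Order.TTheory GRing.Theory Num.Theory.
Import numFieldNormedType.Exports.
Set Implicit Arguments.
Unset Strict Implicit.
Unset Printing Implicit Defensive.
Local Open Scope ring_scope.

(** * Weighted means and Gibbs' inequality *)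

Lemma powR_prod (F : realType) (I : finType) (P : pred I) (x : I -> F) a :
  (forall i, P i -> 0 <= x i) ->
  (\prod_(i | P i) x i) `^ a = \prod_(i | P i) x i `^ a.
Proof.
move=> x0; suff [] : 0 <= \prod_(i | P i) x i /\
  (\prod_(i | P i) x i) `^ a = \prod_(i | P i) x i `^ a by [].
apply: (big_rec2 (fun u v => 0 <= u /\ u `^ a = v)) => [|i u v Pi [v0 <-]].
  by rewrite ler01 powR1.
by rewrite powRM ?mulr_ge0 ?x0.
Qed.

Lemma expR_powR (F : realType) (x a : F) : expR x `^ a = expR (a * x).
Proof. by rewrite mulrC expRM. Qed.

Lemma powR_sum (F : realType) (I : finType) (x : F) (a : I -> F) :
  0 < x -> x `^ (\sum_i a i) = \prod_i x `^ a i.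
Proof.
move=> x0; rewrite /powR gt_eqF // mulr_suml expR_sum.
by apply: eq_bigr.
Qed.

Lemma amgm (F : realType) (I : finType) (alpha x : I -> F) :
  (forall i, 0 <= alpha i) -> \sum_i alpha i = 1 -> (forall i, 0 < x i) ->
  \prod_i x i `^ alpha i <= \sum_i alpha i * x i.
Proof.
move=> alpha0 alpha1 x0; set S := \sum_i _.
have S0 : 0 < S.
  have S_ge0 : 0 <= S by apply: sumr_ge0 => i _; rewrite mulr_ge0 // ltW.
  rewrite lt_neqAle S_ge0 andbT.
  apply/eqP => /esym S0; have : \sum_i alpha i = 0.
    apply: big1 => i _; have /psumr_eq0P /(_ S0 i isT) : forall i, true -> 0 <= alpha i * x i.
      by move=> j _; rewrite mulr_ge0 // ltW.
    by move=> /eqP; rewrite mulf_eq0 (gt_eqF (x0 i)) orbF => /eqP.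
  by rewrite alpha1 => /eqP; rewrite oner_eq0.
have ->: \prod_i x i `^ alpha i = S * \prod_i (x i / S) `^ alpha i.
  have : \prod_i S `^ alpha i = S by rewrite -powR_sum // alpha1 powRr1 // ltW.
  move=> {1}<-; rewrite -big_split; apply: eq_bigr => i _ /=.
  by rewrite -powRM ?ltW ?divr_gt0 // mulrCA divff ?mulr1 ?gt_eqF.
rewrite -[leRHS]mulr1 ler_pM2l //.
apply: (@le_trans _ _ (\prod_i expR (alpha i * (x i / S - 1)))).
  apply: ler_prod => i _; rewrite powR_ge0 /= -expR_powR.
  have y0 : 0 < x i / S by rewrite divr_gt0.
  apply: ge0_ler_powR; rewrite ?nnegrE ?expR_ge0 ?(ltW y0) //.
  by have := expR_ge1Dx (x i / S - 1); rewrite addrC subrK.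
rewrite -expR_sum -[leRHS]expR0 ler_expR.
under eq_bigr do rewrite mulrBr mulr1 mulrA.
by rewrite sumrB -mulr_suml divff ?gt_eqF // alpha1 subrr.
Qed.

(* Gibbs' inequality, with the convention 0 ^ 0 = 1. *)
Lemma gibbs (F : realType) (I : finType) (r : I -> nat) (x : I -> F) :
  (forall i, 0 <= x i) -> \sum_i x i = \sum_i (r i)%:R ->
  \prod_i x i ^+ r i <= \prod_i (r i)%:R ^+ r i.
Proof.
move=> x0 sumE.
apply: (@le_trans _ _ (\prod_i ((r i)%:R ^+ r i * expR (x i - (r i)%:R)))).
  apply: ler_prod => i _; rewrite exprn_ge0 //=.
  case: (posnP (r i)) => [->|r0].
    by rewrite !expr0 mul1r mulr0n subr0 -{1}expR0 ler_expR.
  have rp : 0 < (r i)%:R :> F by rewrite ltr0n.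
  have -> : x i - (r i)%:R = (r i)%:R * (x i / (r i)%:R - 1).
    by rewrite mulrBr mulr1 mulrCA divff ?mulr1 ?gt_eqF.
  rewrite expRM_natl -exprMn lerXn2r ?nnegrE ?mulr_ge0 ?expR_ge0 //.
  rewrite -ler_pdivrMl // mulrC.
  by have := expR_ge1Dx (x i / (r i)%:R - 1); rewrite addrC subrK.
by rewrite big_split -expR_sum sumrB sumE subrr expR0 /= mulr1.
Qed.

(** * The Prekopa-Leindler inequality for polynomials *)

(* The value of the integral of p.[x] * expR (- x) over the half-line x >= 0. *)
Definition laplace (F : realType) (p : {poly F}) : F :=
  \sum_(k < size p) p`_k * k`!%:R.

Definition sum_derivn (F : realType) (p : {poly F}) : {poly F} :=
  \sum_(k < size p) p^`(k).

(* The primitive of x |-> p.[x] * expR (- x) vanishing at 0. *)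
Definition laplace_prim (F : realType) (p : {poly F}) (x : F) : F :=
  laplace p - expR (- x) * (sum_derivn p).[x].

Definition nonneg_poly (F : realType) (p : {poly F}) := forall i, 0 <= p`_i.

Section Laplace.
Variable F : realType.
Implicit Types (p q : {poly F}) (x e : F).

Lemma sum_derivnE p : sum_derivn p - (sum_derivn p)^`() = p.
Proof.
rewrite /sum_derivn raddf_sum /=.
under [X in _ - X]eq_bigr do rewrite -derivnS.
rewrite -(big_mkord xpredT (fun k => p^`(k))) -(big_mkord xpredT (fun k => p^`(k.+1))).
rewrite -sumrB /=; under eq_bigr do rewrite -opprB.
by rewrite sumrN telescope_sumr // derivn_poly0 // sub0r opprK derivn0.
Qed.

Lemma horner_sum_derivn0 p : (sum_derivn p).[0] = laplace p.
Proof.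
rewrite horner_coef0 coef_sum; apply: eq_bigr => i _.
by rewrite coef_derivn addn0 ffactnn mulr_natr.
Qed.

Lemma laplace_prim0 p : laplace_prim p 0 = 0.
Proof. by rewrite /laplace_prim oppr0 expR0 mul1r horner_sum_derivn0 subrr. Qed.

Lemma is_derive_laplace_prim p x :
  is_derive x (1 : F) (laplace_prim p) (expR (- x) * p.[x]).
Proof.
have -> : p.[x] = (sum_derivn p).[x] - (sum_derivn p)^`().[x].
  by rewrite -{1}(sum_derivnE p) hornerD hornerN.
rewrite /laplace_prim; set q := sum_derivn p.
have dq := is_derive_poly q x.
have de : is_derive x (1 : F) (fun y => expR (- y)) (- expR (- x)).
  have := @is_derive1_comp _ expR (fun y => - y) x (expR (- x)) (-1) _ _.
  by rewrite mulrN1; apply.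
apply: is_derive_eq.
rewrite /GRing.scale /= add0r; ring.
Qed.

Lemma continuous_laplace_prim p : continuous (laplace_prim p).
Proof.
move=> x; apply: differentiable_continuous; apply/derivable1_diffP.
by have [] := is_derive_laplace_prim p x.
Qed.

Lemma nonneg_horner p x : nonneg_poly p -> 0 <= x -> 0 <= p.[x].
Proof.
by move=> p0 x0; rewrite horner_coef sumr_ge0 // => i _; rewrite mulr_ge0 ?exprn_ge0.
Qed.

Lemma nonneg_sum_derivn p : nonneg_poly p -> nonneg_poly (sum_derivn p).
Proof.
move=> p0 i; rewrite coef_sum sumr_ge0 // => j _.
by rewrite coef_derivn mulrn_wge0.
Qed.

Lemma laplace_ge0 p : nonneg_poly p -> 0 <= laplace p.
Proof. by move=> p0; rewrite sumr_ge0 // => i _; rewrite mulr_ge0. Qed.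

Lemma laplace_prim_le p x : nonneg_poly p -> 0 <= x -> laplace_prim p x <= laplace p.
Proof.
move=> p0 x0; rewrite gerBl mulr_ge0 ?expR_ge0 // nonneg_horner //.
exact: nonneg_sum_derivn.
Qed.

Lemma laplace_gt0_horner p x : nonneg_poly p -> 0 < laplace p -> 0 < x -> 0 < p.[x].
Proof.
move=> p0 lp x0; rewrite lt_neqAle nonneg_horner ?ltW // andbT.
apply: contraTneq lp => /esym; rewrite horner_coef => /psumr_eq0P E.
rewrite /laplace big1 ?ltxx // => i _.
have /eqP : p`_i * x ^+ i = 0.
  by apply: E => // j _; rewrite mulr_ge0 ?exprn_ge0 // ltW.
by rewrite mulf_eq0 expf_eq0 (gt_eqF x0) andbF orbF => /eqP ->; rewrite mul0r.
Qed.

Lemma expRN_poly_small p e : nonneg_poly p -> 0 < e ->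
  exists2 x, 0 < x & expR (- x) * p.[x] < e.
Proof.
move=> p0 e0; pose n := size p; pose Q := \sum_(i < n) p`_i.
have Q0 : 0 <= Q by rewrite sumr_ge0.
pose x := 1 + Q * n.+1`!%:R / e.
have x1 : 1 <= x by rewrite lerDl divr_ge0 ?mulr_ge0 // ltW.
have x0 : 0 < x by rewrite (lt_le_trans _ x1).
exists x => //.
have px : p.[x] <= Q * x ^+ n.
  rewrite horner_coef mulr_suml; apply: ler_sum => i _.
  by rewrite ler_wpM2l // ler_weXn2l // ltnW.
have ex : x ^+ n.+1 / n.+1`!%:R <= expR x.
  by have := expR_ge1Dxn n (ltW x0); apply: le_trans; rewrite lerDr.
rewrite expRN mulrC ltr_pdivrMr ?expR_gt0 // (le_lt_trans px) //.
apply: (@lt_le_trans _ _ (e * (x ^+ n.+1 / n.+1`!%:R))); last by rewrite ler_pM2l.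
have f0 : 0 < n.+1`!%:R :> F by rewrite ltr0n fact_gt0.
rewrite mulrA ltr_pdivlMr // exprS.
have -> : Q * x ^+ n * n.+1`!%:R = (Q * n.+1`!%:R) * x ^+ n by ring.
rewrite mulrA ltr_pM2r ?exprn_gt0 // /x mulrDr mulr1 mulrCA divff ?gt_eqF // mulr1.
by rewrite ltrDr.
Qed.

Lemma laplace_prim_ge0 p x : nonneg_poly p -> 0 < x -> 0 <= laplace_prim p x.
Proof.
move=> p0 x0; have [z|z] := MVT x0 (fun z _ => is_derive_laplace_prim p z).
  exact/continuous_subspaceT/continuous_laplace_prim.
rewrite in_itv /= laplace_prim0 !subr0 => /andP[z0 _] ->.
by rewrite !mulr_ge0 ?expR_ge0 ?nonneg_horner // ltW.
Qed.

Lemma laplace_prim_mono p x y : nonneg_poly p -> 0 < laplace p ->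
  0 <= x -> x < y -> laplace_prim p x < laplace_prim p y.
Proof.
move=> p0 lp x0 xy.
have [z|z] := MVT xy (fun z _ => is_derive_laplace_prim p z).
  exact/continuous_subspaceT/continuous_laplace_prim.
rewrite in_itv /= => /andP[xz zy] /eqP; rewrite subr_eq => /eqP ->.
by rewrite ltrDr !mulr_gt0 ?expR_gt0 ?laplace_gt0_horner ?subr_gt0 // (le_lt_trans x0).
Qed.

Lemma laplace_quantile p : nonneg_poly p -> 0 < laplace p ->
  exists phi : F -> F, forall u, 0 < u < 1 -> 0 < phi u /\
    is_derive u (1 : F) phi (laplace p * expR (phi u) / p.[phi u]).
Proof.
move=> p0 lp; pose h x := laplace_prim p x / laplace p.
have hmono x y : 0 <= x -> x < y -> h x < h y.
  by move=> x0 xy; rewrite ltr_pM2r ?invr_gt0 // laplace_prim_mono.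
have hcont : continuous h.
  by move=> x; apply: cvgMr_tmp; exact: continuous_laplace_prim.
have h0 : h 0 = 0 by rewrite /h laplace_prim0 mul0r.
have hlt1 x : 0 <= x -> h x < 1.
  move=> x0; have xx : x < x + 1 by rewrite ltrDl.
  apply: (lt_le_trans (hmono _ _ x0 xx)).
  by rewrite ler_pdivrMr // mul1r laplace_prim_le // (le_trans x0) // ltW.
have surj u : exists x, 0 < u < 1 -> 0 < x /\ h x = u.
  have [/andP[u0 u1]|nu] := boolP (0 < u < 1); last by exists 0.
  have e0 : 0 < laplace p * (1 - u) by rewrite mulr_gt0 // subr_gt0.
  have [M M0 HM] := expRN_poly_small (nonneg_sum_derivn p0) e0.
  have uM : u < h M.
    rewrite ltr_pdivlMr // /laplace_prim; lra.
  have [||x] := @IVT F h 0 M u (ltW M0).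
  - exact: continuous_subspaceT.
  - by rewrite h0 ge_min le_max (ltW u0) (ltW uM) orbT.
  rewrite in_itv /= => /andP[x0 _] hx; exists x => _; split => //.
  rewrite lt_neqAle x0 andbT; apply: contraTneq u0 => x0'.
  by rewrite -hx -x0' h0 ltxx.
have [phi phiP] := choice surj; exists phi => u u01.
have [phi0 hphi] := phiP u u01; split => //.
have pphi := laplace_gt0_horner p0 lp phi0.
have -> : laplace p * expR (phi u) / p.[phi u] =
    (expR (- phi u) * p.[phi u] / laplace p)^-1.
  rewrite expRN; field.
  by rewrite !gt_eqF ?expR_gt0.
rewrite -{1}hphi; apply: (@is_derive_inverse _ h).
- near=> z; have z0 : 0 < z by near: z; exact: lt_nbhsr.
  have hz : 0 < h z < 1 by rewrite -{1}h0 hmono //= hlt1 // ltW.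
  have [w0 hw] := phiP _ hz.
  have [wz|zw|//] := ltgtP (phi (h z)) z.
    by have := hmono _ _ (ltW w0) wz; rewrite hw ltxx.
  by have := hmono _ _ (ltW z0) zw; rewrite hw ltxx.
- by near=> z; exact: hcont.
- have d := is_derive_laplace_prim p (phi u).
  apply: is_derive_eq; rewrite /GRing.scale /=; ring.
- by rewrite gt_eqF // divr_gt0 // mulr_gt0 ?expR_gt0.
Unshelve. all: by end_near.
Qed.

End Laplace.

Section Prekopa.
Variables (F : realType) (n : nat) (alpha : 'I_n -> F).
Hypotheses (alpha_ge0 : forall i, 0 <= alpha i) (alpha_sum : \sum_i alpha i = 1).

Lemma conv_gt0 (x : 'I_n -> F) : (forall i, 0 < x i) -> 0 < \sum_i alpha i * x i.
Proof.
move=> x0; apply: (lt_le_trans _ (amgm alpha_ge0 alpha_sum x0)).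
by rewrite prodr_gt0 // => i _; rewrite powR_gt0.
Qed.

(* Transport: moving each p_ i to the uniform distribution on ]0, 1[ by its quantile
   function, the averaged quantile function pushes at least the geometric mean of the
   masses into q. *)
Lemma laplace_prekopa_gt0 (p_ : 'I_n -> {poly F}) (q : {poly F}) :
  (forall i, nonneg_poly (p_ i)) -> nonneg_poly q ->
  (forall i, 0 < laplace (p_ i)) ->
  (forall x : 'I_n -> F, (forall i, 0 < x i) ->
     \prod_i (p_ i).[x i] `^ alpha i <= q.[ \sum_i alpha i * x i]) ->
  \prod_i laplace (p_ i) `^ alpha i <= laplace q.
Proof.
move=> p0 q0 lp le_pq; set L := \prod_i _.
have [phi phiP] := choice (fun i => laplace_quantile (p0 i) (lp i)).
have phi0 (u : F) (u01 : 0 < u < 1) i : 0 < phi i u by have [] := phiP i u u01.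
pose z : F -> F := \sum_i (alpha i *: phi i).
have zE u : z u = \sum_i alpha i * phi i u by rewrite /z fct_sumE.
pose dphi u i := laplace (p_ i) * expR (phi i u) / (p_ i).[phi i u].
have dz (u : F) : 0 < u < 1 -> is_derive u (1 : F) z (\sum_i alpha i * dphi u i).
  move=> u01; apply: is_derive_sum => i.
  have [_ d] := phiP i u u01; exact: is_deriveZ.
pose d (u : F) := expR (- z u) * q.[z u] * (\sum_i alpha i * dphi u i).
have dP (u : F) : 0 < u < 1 -> is_derive u (1 : F) (laplace_prim q \o z) (d u).
  move=> u01; apply: is_derive1_comp; first exact: is_derive_laplace_prim.
  exact: dz.
have Ld (u : F) : 0 < u < 1 -> L <= d u.
  move=> u01; have php i := laplace_gt0_horner (p0 i) (lp i) (phi0 u u01 i).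
  have dphi0 i : 0 < dphi u i by rewrite divr_gt0 ?mulr_gt0 ?expR_gt0.
  have -> : L = expR (- z u) * \prod_i (p_ i).[phi i u] `^ alpha i *
      \prod_i dphi u i `^ alpha i.
    rewrite -mulrA -big_split /=.
    under [in RHS]eq_bigr => i _.
      rewrite -powRM ?ltW // /dphi mulrC divfK ?gt_eqF //.
      rewrite powRM ?expR_ge0 ?ltW // expR_powR; over.
    by rewrite big_split -expR_sum -zE /= mulrCA expRN mulVf ?mulr1 // gt_eqF ?expR_gt0.
  apply: ler_pM.
  - by rewrite mulr_ge0 ?expR_ge0 // prodr_ge0 // => i _; exact: powR_ge0.
  - by apply: prodr_ge0 => i _; exact: powR_ge0.
  - by rewrite ler_pM2l ?expR_gt0 // zE; apply: le_pq => i; exact: phi0.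
  - exact: amgm.
have Luv (u v : F) : 0 < u -> u < v -> v < 1 -> L * (v - u) <= laplace q.
  move=> u0 uv v1.
  have sub w : w \in `[u, v] -> 0 < w < 1.
    by rewrite in_itv /= => /andP[uw wv]; rewrite (lt_le_trans u0 uw) (le_lt_trans wv).
  have [w wuv||w] := @MVT F (laplace_prim q \o z) d u v uv.
  - by apply: dP; apply: sub; move: wuv; rewrite !in_itv /= => /andP[? ?]; rewrite !ltW.
  - apply: derivable_within_continuous => w /sub w01.
    by have [] := dP w w01.
  move=> wuv E.
  have w01 : 0 < w < 1.
    by apply: sub; move: wuv; rewrite !in_itv /= => /andP[? ?]; rewrite !ltW.
  apply: (@le_trans _ _ (d w * (v - u))).
    by rewrite ler_wpM2r ?Ld // subr_ge0 ltW.
  have z0 y : 0 < y < 1 -> 0 < z y.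
    by move=> y01; rewrite zE; apply: conv_gt0 => i; exact: phi0.
  rewrite -E /= lerBlDr -[leLHS]addr0 lerD //.
    by rewrite laplace_prim_le // ltW // z0 // v1 (lt_trans u0).
  by apply: laplace_prim_ge0 => //; apply: z0; rewrite u0 (lt_trans uv).
apply/ler_addgt0Pr => e e0.
have L0 : 0 <= L by rewrite prodr_ge0 // => i _; exact: powR_ge0.
pose a := e / (2 * (L + e) + e).
have den0 : 0 < 2 * (L + e) + e by lra.
have a0 : 0 < a by rewrite divr_gt0.
have a1 : a < 1 / 2 by rewrite ltr_pdivrMr //; lra.
have := Luv a (1 - a) a0 _ _.
have : L * a *+ 2 <= e.
  rewrite mulrA -mulrnAl ler_pdivrMr //; nra.
rewrite mulr2n => h1 h2; have := h2 ltac:(lra) ltac:(lra); lra.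
Qed.

Lemma laplace_prekopa (p_ : 'I_n -> {poly F}) (q : {poly F}) :
  (forall i, nonneg_poly (p_ i)) -> nonneg_poly q ->
  (forall x : 'I_n -> F, (forall i, 0 < x i) ->
     \prod_i (p_ i).[x i] `^ alpha i <= q.[ \sum_i alpha i * x i]) ->
  \prod_i laplace (p_ i) `^ alpha i <= laplace q.
Proof.
move=> p0 q0 le_pq.
have [|] := boolP [forall i, (alpha i != 0) ==> (laplace (p_ i) != 0)]; last first.
  rewrite negb_forall => /existsP[k]; rewrite negb_imply negbK => /andP[ak /eqP Lk].
  by rewrite (bigD1 k) //= Lk powR0 // mul0r laplace_ge0.
move=> /forallP lp.
pose p' i : {poly F} := if alpha i == 0 then 1 else p_ i.
have laplace1 : laplace (1 : {poly F}) = 1.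
  by rewrite /laplace size_poly1 big_ord1 coef1 mulr1.
have -> : \prod_i laplace (p_ i) `^ alpha i = \prod_i laplace (p' i) `^ alpha i.
  by apply: eq_bigr => i _; rewrite /p'; case: eqP => // ->; rewrite !powRr0.
apply: laplace_prekopa_gt0 => // [i j|i|x x0].
- by rewrite /p'; case: ifP => _; [rewrite coef1; case: (j == 0%N)|exact: p0].
- rewrite /p'; case: ifP => [|/negbT ai]; first by rewrite laplace1.
  have := lp i; rewrite ai /= => L0.
  by rewrite lt_neqAle eq_sym L0 laplace_ge0.
- have := le_pq x x0; congr (_ <= _).
  by apply: eq_bigr => i _; rewrite /p'; case: eqP => // ->; rewrite !powRr0.
Qed.
End Prekopa.

Lemma laplace_widen (F : realType) (p : {poly F}) n : (size p <= n)%N ->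
  laplace p = \sum_(k < n) p`_k * k`!%:R.
Proof.
move=> pn; rewrite /laplace (big_ord_widen n (fun k => p`_k * k`!%:R)) // big_mkcond.
apply: eq_bigr => i _; case: ltnP => // pi.
by rewrite nth_default // mul0r.
Qed.

Lemma laplace_sum_monom (F : realType) (S : finType) (a : S -> F) (d : S -> nat) :
  laplace (\sum_s a s *: 'X^(d s)) = \sum_s a s * (d s)`!%:R.
Proof.
pose n := (\max_s d s).+1.
have dn s : (d s < n)%N by rewrite ltnS leq_bigmax.
rewrite (@laplace_widen _ _ n); last first.
  apply: (leq_trans (size_sum _ _ _)); apply/bigmax_leqP => s _.
  rewrite (leq_trans (size_scale_leq _ _)) //.
  by rewrite size_polyXn.
under eq_bigr => k _ do rewrite coef_sum mulr_suml.
rewrite exchange_big /=; apply: eq_bigr => s _.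
rewrite (bigD1 (Ordinal (dn s))) //= coefZ coefXn eqxx mulr1 big1 ?addr0 // => k.
by rewrite -val_eqE /= coefZ coefXn => /negbTE ->; rewrite mulr0 mul0r.
Qed.

Section MultiPrekopa.
Variables (F : realType) (n : nat) (alpha : 'I_n -> F).
Hypotheses (alpha_ge0 : forall i, 0 <= alpha i) (alpha_sum : \sum_i alpha i = 1).
Variables (E S : finType) (d : S -> E -> nat).

(* The polynomial with coefficients c, after integrating the variables in D against
   the exponential weight. *)
Let part (D : {set E}) (c : S -> F) (g : E -> F) : F :=
  \sum_s c s * (\prod_(x in D) (d s x)`!%:R) * \prod_(x | x \notin D) g x ^+ d s x.

Let upd (g : E -> F) (y : E) (t : F) (x : E) : F := if x == y then t else g x.

Lemma monomial_prekopa (c_ : 'I_n -> S -> F) (c : S -> F) :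
  (forall i s, 0 <= c_ i s) -> (forall s, 0 <= c s) ->
  (forall g : 'I_n -> E -> F, (forall i x, 0 < g i x) ->
    \prod_i (\sum_s c_ i s * \prod_x g i x ^+ d s x) `^ alpha i <=
    \sum_s c s * \prod_x (\sum_i alpha i * g i x) ^+ d s x) ->
  \prod_i (\sum_s c_ i s * \prod_x (d s x)`!%:R) `^ alpha i <=
  \sum_s c s * \prod_x (d s x)`!%:R.
Proof.
move=> c_0 c0 le_c.
suff H D (g : 'I_n -> E -> F) : (forall i x, 0 < g i x) ->
    \prod_i part D (c_ i) (g i) `^ alpha i <=
    part D c (fun x => \sum_i alpha i * g i x).
  have E1 a h : part finset.setT a h = \sum_s a s * \prod_x (d s x)`!%:R.
    apply: eq_bigr => s _; rewrite [X in _ * X = _]big1 => [|x]; last by rewrite inE.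
    by rewrite mulr1; congr (_ * _); apply: eq_bigl => x; rewrite inE.
  have := H finset.setT (fun _ _ => 1) (fun _ _ => ltr01); rewrite E1.
  by under eq_bigr do rewrite E1.
move: {2}#|D| (erefl #|D|) => k; elim: k D g => [|k IH] D g cD g0.
  have E1 a h : part D a h = \sum_s a s * \prod_x h x ^+ d s x.
    apply: eq_bigr => s _; rewrite [X in _ * X * _]big1 => [|x].
      rewrite mulr1; congr (_ * _); apply: eq_bigl => x.
      by rewrite (cards0_eq cD) inE.
    by rewrite (cards0_eq cD) inE.
  by under eq_bigr do rewrite E1; rewrite E1; exact: le_c.
have [y yD] : exists y, y \in D by apply/set0Pn; rewrite -card_gt0 cD.
pose a b (h : E -> F) s := b s * (\prod_(x in D :\ y) (d s x)`!%:R) *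
  \prod_(x | x \notin D) h x ^+ d s x.
pose pol b h : {poly F} := \sum_s a b h s *: 'X^(d s y).
have a0 b h s : (forall s, 0 <= b s) -> (forall x, 0 < h x) -> 0 <= a b h s.
  move=> b0 h0; rewrite !mulr_ge0 // prodr_ge0 // => x _.
  by rewrite exprn_ge0 // ltW.
have partE b h : part D b h = laplace (pol b h).
  rewrite laplace_sum_monom; apply: eq_bigr => s _.
  by rewrite (big_setD1 y) //= /a; ring.
have polE b h t : (pol b h).[t] = part (D :\ y) b (upd h y t).
  rewrite horner_sum; apply: eq_bigr => s _.
  rewrite hornerZ hornerXn /a -!mulrA; congr (_ * (_ * _)).
  rewrite [RHS](bigD1 y) /=; last by rewrite !inE eqxx.
  rewrite mulrC /upd eqxx; congr (_ * _); apply: eq_big => x.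
    by rewrite !inE negb_and negbK; case: eqP => [->|]; rewrite ?yD ?andbF ?andbT.
  by move=> xD; rewrite ifN //; apply: contraNN xD => /eqP ->.
have pol0 b h : (forall s, 0 <= b s) -> (forall x, 0 < h x) -> nonneg_poly (pol b h).
  move=> b0 h0 i; rewrite coef_sum sumr_ge0 // => s _; rewrite coefZ coefXn.
  by rewrite mulr_ge0 ?a0.
rewrite partE; under eq_bigr do rewrite partE.
apply: (laplace_prekopa alpha_ge0 alpha_sum) => [i||t t0].
- exact: pol0.
- by apply: pol0 => // x; exact: conv_gt0.
rewrite polE; under eq_bigr do rewrite polE.
have := IH (D :\ y) (fun i => upd (g i) y (t i)); rewrite cardsDS ?finset.sub1set //.
rewrite cD cards1 subn1 => /(_ erefl) H.
apply: le_trans (H _) _ => [i x|].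
  by rewrite /upd; case: ifP.
rewrite le_eqVlt; apply/orP; left; apply/eqP; congr part; apply/funext => x.
by rewrite /upd; case: ifP.
Qed.

End MultiPrekopa.

(** * Capacity of real-rooted polynomials *)

Lemma newton_roots (F : realFieldType) (s : seq F) : all (fun a => 0 < a) s ->
  exists w : nat -> F, [/\ forall k, (k <= size s)%N -> 0 < w k,
    forall k, (k.+2 <= size s)%N -> w k * w k.+2 <= w k.+1 ^+ 2 &
    forall k, (\prod_(a <- s) ('X + a%:P))`_k = 'C(size s, k)%:R * w k].
Proof.
elim: s => [_|a s IH /= /andP[a0 /IH[w [w0 wlc wE]]]].
  exists (fun _ => 1); split=> // k; rewrite big_nil coef1 bin0n mulr1.
  by case: (k == 0%N).
set N := size s in w0 wlc wE *.
exists (fun k => (a * (N.+1 - k)%:R * w k + k%:R * w k.-1) / N.+1%:R).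
have N0 : 0 < N.+1%:R :> F by rewrite ltr0n.
split.
- move=> k kN; rewrite divr_gt0 //.
  have [kN1|kN1] := ltnP k N.+1.
    rewrite ltr_pwDl ?mulr_gt0 ?ltr0n ?subn_gt0 ?w0 //.
    case: k {kN} kN1 => [|k] kN1; first by rewrite mul0r.
    by rewrite mulr_ge0 // ltW // w0 // ltnW.
  have -> : k = N.+1 by apply/eqP; rewrite eqn_leq kN kN1.
  by rewrite subnn mulr0 mul0r add0r mulr_gt0 // w0.
- move=> k kN /=.
  have -> (x y z : F) : (x / N.+1%:R * (y / N.+1%:R) <= (z / N.+1%:R) ^+ 2) =
      (x * y <= z ^+ 2).
    by rewrite expr_div_n mulrACA -invfM -expr2 ler_pM2r ?invr_gt0 ?exprn_gt0.
  have [M NE] : exists M, N = (M + k.+1)%N by exists (N - k.+1)%N; rewrite subnK.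
  rewrite NE; have -> : ((M + k.+1).+1 - k = M.+2)%N by lia.
  have -> : ((M + k.+1).+1 - k.+1 = M.+1)%N by lia.
  have -> : ((M + k.+1).+1 - k.+2 = M)%N by lia.
  have h1 : M%:R * (w k * w k.+2) <= M%:R * w k.+1 ^+ 2.
    case: (posnP M) => [->|M0]; first by rewrite !mul0r.
    by rewrite ler_wpM2l // wlc // NE; lia.
  have h2 : k%:R * (w k.-1 * w k.+1) <= k%:R * w k ^+ 2.
    case: k {h1} NE kN => [|k] NE kN; first by rewrite !mul0r.
    by rewrite ler_wpM2l // wlc // NE; lia.
  have h3 : k%:R * M%:R * (w k.-1 * w k.+2) <= k%:R * M%:R * (w k * w k.+1).
    have [->|M0] := posnP M; first by rewrite mulr0 !mul0r.
    have [->|k0] := posnP k; first by rewrite !mul0r.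
    rewrite ler_wpM2l ?mulr_ge0 //.
    have p0 : 0 < w k by apply: w0; rewrite NE; lia.
    have p1 : 0 < w k.+1 by apply: w0; rewrite NE; lia.
    have p2 : 0 < w k.+2 by apply: w0; rewrite NE; lia.
    have py : 0 < w k.-1 by apply: w0; rewrite NE; lia.
    have g1 : w k * w k.+2 <= w k.+1 ^+ 2 by apply: wlc; rewrite NE; lia.
    have g2 : w k.-1 * w k.+1 <= w k ^+ 2.
      by have := wlc k.-1; rewrite prednK //; apply; rewrite NE; lia.
    rewrite -(ler_pM2r (mulr_gt0 p0 p1)).
    have -> : w k.-1 * w k.+2 * (w k * w k.+1) = (w k.-1 * w k.+1) * (w k * w k.+2).
      by ring.
    have -> : w k * w k.+1 * (w k * w k.+1) = w k ^+ 2 * w k.+1 ^+ 2 by ring.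
    by apply: ler_pM => //; rewrite mulr_ge0 // ltW.
  rewrite -subr_ge0.
  move: (w k.-1) (w k) (w k.+1) (w k.+2) h1 h2 h3 => y x0 x1 x2 h1 h2 h3.
  rewrite -(natr1 M.+1) -(natr1 M) -(natr1 k.+1) -(natr1 k).
  move: (M%:R : F) (k%:R : F) (ler0n F M) (ler0n F k) h1 h2 h3.
  move=> m l m0 l0 h1 h2 h3.
  have -> : (a * (m + 1) * x1 + (l + 1) * x0) ^+ 2 -
      (a * (m + 1 + 1) * x0 + l * y) * (a * m * x2 + (l + 1 + 1) * x1) =
      a ^+ 2 * (m + 2) * (m * x1 ^+ 2 - m * (x0 * x2)) +
      (l + 2) * (l * x0 ^+ 2 - l * (y * x1)) +
      a * (l * m * (x0 * x1) - l * m * (y * x2)) + (a * x1 - x0) ^+ 2 by ring.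
  rewrite !addr_ge0 ?sqr_ge0 // !mulr_ge0 ?subr_ge0 ?sqr_ge0 ?addr_ge0 // ltW //.
- move=> k; rewrite big_cons mulrDl coefD coefXM mul_polyC coefZ !wE.
  apply: (mulIf (lt0r_neq0 N0)); rewrite -[RHS]mulrA divfK ?(lt0r_neq0 N0) //.
  have b1 : N.+1%:R * 'C(N, k)%:R = (N.+1 - k)%:R * 'C(N.+1, k)%:R :> F.
    by rewrite -!natrM -mul_bin_down.
  have b2 : k%:R * 'C(N.+1, k)%:R = if k == 0%N then 0 else N.+1%:R * 'C(N, k.-1)%:R :> F.
    by case: k {b1} => [|k]; rewrite ?mul0r // -!natrM -mul_bin_diag.
  rewrite mulrDr [RHS]addrC.
  have -> : 'C(N.+1, k)%:R * (k%:R * w k.-1) = k%:R * 'C(N.+1, k)%:R * w k.-1 by ring.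
  have -> : 'C(N.+1, k)%:R * (a * (N.+1 - k)%:R * w k) =
    a * ((N.+1 - k)%:R * 'C(N.+1, k)%:R) * w k by ring.
  rewrite -b1 b2; case: (k == 0%N); ring.
Qed.

Lemma log_concave_support (F : realFieldType) (w : nat -> F) N r : (r <= N)%N ->
  (forall k, (k <= N)%N -> 0 < w k) ->
  (forall k, (k.+2 <= N)%N -> w k * w k.+2 <= w k.+1 ^+ 2) ->
  exists2 l, 0 < l & forall k, (k <= N)%N -> w k * l ^+ r <= w r * l ^+ k.
Proof.
move=> rN w0 wlc; pose rho k := w k.+1 / w k.
have rho_step k : (k.+2 <= N)%N -> rho k.+1 <= rho k.
  move=> kN; rewrite /rho ler_pdivrMr ?w0 //; last exact: ltnW.
  rewrite mulrAC ler_pdivlMr ?w0 //; last by rewrite ltnW // ltnW.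
  by rewrite mulrC -expr2 wlc.
have rho_le i j : (i <= j)%N -> (j < N)%N -> rho j <= rho i.
  move=> ij; rewrite -(subnKC ij); elim: (j - i)%N => [|d IH]; first by rewrite addn0.
  by rewrite addnS => jN; apply: le_trans (rho_step _ jN) (IH (ltnW jN)).
have [l [l0 l_lo l_up]] : exists l, [/\ 0 < l,
    forall i, (i < r)%N -> l <= rho i & forall i, (r <= i)%N -> (i < N)%N -> rho i <= l].
  have [rN1|Nr] := ltnP r N.
    exists (rho r); split=> [|i ir|i ri iN]; last exact: rho_le.
      by rewrite divr_gt0 // w0 // ltnW.
    by apply: rho_le => //; exact: ltnW.
  have rE : r = N by apply/eqP; rewrite eqn_leq rN.
  case: N => [|N'] in rN w0 wlc rho_step rho_le Nr rE *.
    by exists 1; split=> // i; rewrite rE.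
  exists (rho N'); split=> [|i|i ri iN]; first by rewrite divr_gt0 // w0.
    by rewrite rE ltnS => iN; apply: rho_le.
  by move: iN; rewrite ltnNge -{1}rE ri.
have wS k : (k < N)%N -> w k.+1 = w k * rho k.
  by move=> kN; rewrite /rho mulrC divfK // gt_eqF // w0 // ltnW.
exists l => // k kN; have [kr|rk] := leqP k r.
  rewrite -(subnKC kr) in rN l_lo *; move: (r - k)%N rN l_lo => d.
  elim: d => [|d IH] dN llo; first by rewrite addn0.
  rewrite addnS exprS mulrCA wS -?addnS //.
  rewrite [leRHS]mulrAC [leRHS]mulrC; apply: ler_pM.
  - exact: ltW.
  - by rewrite mulr_ge0 ?exprn_ge0 ?ltW // w0.
  - by apply: llo; rewrite addnS.
  - by apply: IH => [|i id]; [lia|apply: llo; rewrite addnS ltnW].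
rewrite -(subnKC (ltnW rk)) in kN *; move: (k - r)%N kN => d.
elim: d => [|d IH] dN; first by rewrite addn0.
rewrite addnS exprS wS; last by rewrite -addnS.
rewrite [leLHS]mulrAC [leRHS]mulrCA [leLHS]mulrC; apply: ler_pM.
- by rewrite divr_ge0 // ltW // w0 -?addnS //; lia.
- by rewrite mulr_ge0 ?exprn_ge0 ?ltW // w0 //; lia.
- by apply: l_up; lia.
- by apply: IH; lia.
Qed.

Lemma le_limit_exprn (F : realType) (x A y : F) n :
  (forall e, 0 < e -> x <= A * (y + e) ^+ n) -> x <= A * y ^+ n.
Proof.
move=> H; rewrite leNgt; apply/negP => lt_x.
pose p : {poly F} := A *: 'X^n.
have pE z : p.[z] = A * z ^+ n by rewrite hornerZ hornerXn.
have /cvgr_lt/(_ x) := @continuous_horner _ p y; rewrite pE => /(_ lt_x).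
move=> /nbhs_ballP[e /= e0 He].
have /He : ball y e (y + e / 2).
  by rewrite /ball /= opprD addrA subrr sub0r normrN gtr0_norm; lra.
by rewrite /= pE ltNge H // divr_gt0.
Qed.

Lemma omega_gt0 (F : realType) n : 0 < omega F n.
Proof.
rewrite divr_gt0 ?ltr0n ?fact_gt0 // -natrX ltr0n expn_gt0.
by case: n.
Qed.

(* The constant is optimal: equality holds when all the roots coincide. *)
Lemma capacity_roots (F : realType) (s : seq F) (c kappa : F) r :
  all (fun a => 0 < a) s -> 0 <= c -> 0 <= kappa -> (r <= size s)%N ->
  (forall t, 0 < t -> kappa * t ^+ r <= c * (\prod_(a <- s) ('X + a%:P)).[t]) ->
  kappa * (omega F r * omega F (size s - r) / omega F (size s)) <=
    c * (\prod_(a <- s) ('X + a%:P))`_r.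
Proof.
move=> s0 c0 k0 rN H; have [w [w0 wlc wE]] := newton_roots s0.
set p := \prod_(a <- s) _ in H wE *; set N := size s in rN w0 wlc wE *.
have [l l0 lP] := log_concave_support rN w0 wlc.
have sp : (size p <= N.+1)%N.
  by apply/leq_sizeP => j jN; rewrite wE bin_small // mul0r.
have pt t : 0 < t -> p.[t] * l ^+ r <= w r * (1 + l * t) ^+ N.
  move=> t0; rewrite (horner_coef_wide _ sp) exprDn mulr_suml mulr_sumr.
  apply: ler_sum => i _; rewrite wE expr1n mul1r exprMn -[(_ * _) *+ _]mulr_natl.
  have -> : 'C(N, i)%:R * w i * t ^+ i * l ^+ r = 'C(N, i)%:R * t ^+ i * (w i * l ^+ r).
    by ring.
  have -> : w r * ('C(N, i)%:R * (l ^+ i * t ^+ i)) =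
    'C(N, i)%:R * t ^+ i * (w r * l ^+ i) by ring.
  rewrite ler_wpM2l ?mulr_ge0 ?exprn_ge0 ?(ltW t0) // lP //.
  by rewrite -ltnS.
have hu u : 0 < u -> kappa * u ^+ r <= c * w r * (1 + u) ^+ N.
  move=> u0; have t0 : 0 < u / l by rewrite divr_gt0.
  have := H _ t0; rewrite -(ler_pM2r (exprn_gt0 r l0)) => h1.
  have -> : u ^+ r = (u / l) ^+ r * l ^+ r by rewrite -exprMn divfK // gt_eqF.
  rewrite mulrA (le_trans h1) // -!mulrA ler_wpM2l //.
  by have := pt _ t0; rewrite mulrCA divff ?mulr1 // gt_eqF.
have huv u v : 0 < u -> 0 < v -> kappa * u ^+ r * v ^+ (N - r) <= c * w r * (u + v) ^+ N.
  move=> u0 v0; have uv0 : 0 < u / v by rewrite divr_gt0.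
  have := hu _ uv0; rewrite -(ler_pM2r (exprn_gt0 N v0)) -[leRHS]mulrA -exprMn.
  rewrite mulrDl mul1r divfK ?gt_eqF // [v + u]addrC; apply: le_trans.
  rewrite -{2}(subnK rN) exprD expr_div_n.
  by rewrite le_eqVlt; apply/orP; left; apply/eqP; field; rewrite expf_neq0 // gt_eqF.
have h : kappa * (r%:R ^+ r * (N - r)%:R ^+ (N - r)) <= c * w r * N%:R ^+ N.
  apply: le_limit_exprn => e e0; have e2 : 0 < e / 2 by rewrite divr_gt0.
  have NE : N%:R + e = (r%:R + e / 2) + ((N - r)%:R + e / 2) :> F.
    by rewrite natrB //; field.
  rewrite NE; apply: le_trans (huv _ _ _ _); last 2 first.
  - by rewrite ltr_wpDl.
  - by rewrite ltr_wpDl.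
  rewrite -mulrA ler_wpM2l // ler_pM ?exprn_ge0 //.
    by rewrite lerXn2r ?nnegrE ?addr_ge0 ?(ltW e2) // lerDl ltW.
  by rewrite lerXn2r ?nnegrE ?addr_ge0 ?(ltW e2) // lerDl ltW.
have -> : omega F r * omega F (N - r) / omega F N =
    (r%:R ^+ r * (N - r)%:R ^+ (N - r)) / N%:R ^+ N * 'C(N, r)%:R.
  have NN : N%:R ^+ N != 0 :> F.
    by rewrite -natrX pnatr_eq0 -lt0n expn_gt0; case: (N).
  have f0 n : n`!%:R != 0 :> F by rewrite pnatr_eq0 -lt0n fact_gt0.
  rewrite /omega -(bin_fact rN) !natrM.
  have b0 : 'C(N, r)%:R != 0 :> F by rewrite pnatr_eq0 -lt0n bin_gt0.
  by field; rewrite NN b0 !f0.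
have NN : 0 < N%:R ^+ N :> F.
  by rewrite -natrX ltr0n expn_gt0; case: (N).
rewrite wE [leRHS]mulrCA [leRHS]mulrC !mulrA ler_wpM2r //.
by rewrite ler_pdivrMr // -[leLHS]mulrA.
Qed.

(** * Stable polynomials *)

Definition hurwitz (F : rcfType) (p : {poly F[i]}) :=
  forall z, 0 <= complex.Re z -> p.[z] != 0.

Section Hurwitz.
Variable F : rcfType.
Implicit Types (p : {poly F[i]}) (z : F[i]).

Lemma ReD z1 z2 : complex.Re (z1 + z2) = complex.Re z1 + complex.Re z2.
Proof. by case: z1 z2 => [a b] [c d]. Qed.

Lemma ReN z : complex.Re (- z) = - complex.Re z.
Proof. by case: z. Qed.

Lemma ReV_gt0 z : 0 < complex.Re z -> 0 < complex.Re z^-1.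
Proof.
case: z => a b /= a0; rewrite divr_gt0 // ltr_pwDl ?sqr_ge0 //.
by rewrite exprn_gt0.
Qed.

Lemma log_deriv_roots (s : seq F[i]) z : 0 <= complex.Re z ->
  all (fun a => complex.Re a < 0) s ->
  let p := \prod_(a <- s) ('X - a%:P) in
  p.[z] != 0 /\ (s != [::] -> 0 < complex.Re (p^`().[z] / p.[z])).
Proof.
move=> z0 /=; elim: s => [_|a s IH /= /andP[a0 /IH[p0 dp]]].
  by rewrite big_nil hornerC oner_neq0.
rewrite !big_cons hornerM hornerXsubC derivM derivXsubC mul1r hornerD hornerM.
rewrite hornerXsubC; set p := \prod_(j <- s) _ in p0 dp *.
have za : 0 < complex.Re (z - a) by rewrite ReD ReN subr_gt0 (lt_le_trans a0).
have za0 : z - a != 0 by apply: contraTneq za => ->; rewrite ltxx.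
split=> [|_]; first by rewrite mulf_neq0.
have -> : (p.[z] + (z - a) * p^`().[z]) / ((z - a) * p.[z]) =
    (z - a)^-1 + p^`().[z] / p.[z] by field; rewrite p0 za0.
rewrite ReD ltr_pwDl ?ReV_gt0 //.
have [s0|s0] := eqVneq s [::]; last by rewrite ltW // dp.
by rewrite /p s0 big_nil derivC horner0 mul0r.
Qed.

(* Gauss-Lucas for a half-plane. *)
Lemma hurwitz_deriv p : hurwitz p -> (1 < size p)%N -> hurwitz p^`().
Proof.
move=> hp sp z z0; have [s pE] := closed_field_poly_normal p.
have lc : lead_coef p != 0 by rewrite lead_coef_eq0 -size_poly_eq0; case: size sp.
have s_neg : all (fun a => complex.Re a < 0) s.
  apply/allP => a a_s; rewrite ltNge; apply/negP => /hp; rewrite pE hornerZ mulf_eq0.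
  rewrite (negPf lc) /= => /negP; apply.
  by rewrite -[_ == 0]/(root _ a) root_prod_XsubC.
have [q0 dq] := log_deriv_roots z0 s_neg.
have s0 : s != [::].
  apply: contraTneq sp => s0; rewrite pE s0 big_nil.
  by rewrite -leqNgt (leq_trans (size_scale_leq _ _)) // size_poly1.
rewrite pE derivZ hornerZ mulf_neq0 //.
by apply: contraTneq (dq s0) => ->; rewrite mul0r ltxx.
Qed.

Lemma hurwitz_coef p r : hurwitz p -> (r < size p)%N -> p`_r != 0.
Proof.
move=> hp rp; suff hr : hurwitz p^`(r).
  have := hr 0 (lexx _); rewrite horner_coef0 coef_derivn addn0.
  by apply: contraNneq => ->; rewrite mul0rn.
elim: r rp => [_|r IH rp]; first by rewrite derivn0.
rewrite derivnS; apply: hurwitz_deriv; first exact/IH/ltnW.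
rewrite ltnNge; apply/negP => /leq_sizeP/(_ ((size p).-1 - r)%N); rewrite coef_derivn.
have -> : (r + ((size p).-1 - r) = (size p).-1)%N by lia.
have lc : lead_coef p != 0 by rewrite lead_coef_eq0 -size_poly_eq0; lia.
move=> /(_ ltac:(lia))/eqP; rewrite -/(lead_coef p) mulrn_eq0 (negPf lc) orbF.
by have := ffact_gt0 (size p).-1 r; lia.
Qed.

End Hurwitz.

Section Elimination.
Variables (I S : finType) (d : S -> I -> nat) (r : I -> nat) (N : nat).

Let agree (D : {set I}) (s : S) := [forall i in D, d s i == r i].

(* The variables in D have been eliminated by extracting their coefficient of x^r. *)
Definition coef_part (R : comNzRingType) (D : {set I}) (a : S -> R) (x : I -> R) : R :=
  \sum_(s | agree D s) a s * \prod_(i | i \notin D) x i ^+ d s i.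

Definition set_var (T : Type) (x : I -> T) (y : I) (t : T) (i : I) : T :=
  if i == y then t else x i.

Definition var_poly (R : comNzRingType) (D : {set I}) (y : I) (a : S -> R)
    (x : I -> R) : {poly R} :=
  \sum_(s | agree D s) (a s * \prod_(i | i \notin y |: D) x i ^+ d s i) *: 'X^(d s y).

Definition rest (D : {set I}) : nat := (N - \sum_(i in D) r i)%N.

Lemma coef_part0 (R : comNzRingType) (a : S -> R) x :
  coef_part finset.set0 a x = \sum_s a s * \prod_i x i ^+ d s i.
Proof.
apply: eq_big => [s|s _]; first by apply/forall_inP => i; rewrite inE.
by congr (_ * _); apply: eq_bigl => i; rewrite inE.
Qed.

Section Ring.
Variables (R : comNzRingType) (a : S -> R).
Hypothesis homog : forall s, a s != 0 -> (\sum_i d s i = N)%N.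
Variables (D : {set I}) (y : I).
Hypothesis yD : y \notin D.

Lemma prod_notin_setU1 (T : comPzSemiRingType) (g : I -> T) :
  \prod_(i | i \notin D) g i = g y * \prod_(i | i \notin y |: D) g i.
Proof.
rewrite (bigD1 y) //=; congr (_ * _); apply: eq_bigl => i.
by rewrite !inE negb_or andbC.
Qed.

Lemma horner_var_poly x t :
  (var_poly D y a x).[t] = coef_part D a (set_var x y t).
Proof.
rewrite horner_sum; apply: eq_bigr => s _.
rewrite hornerZ hornerXn prod_notin_setU1 /set_var eqxx -mulrA; congr (_ * _).
rewrite mulrC; congr (_ * _); apply: eq_bigr => i iD.
by rewrite ifN //; apply: contraNN iD => /eqP ->; rewrite !inE eqxx.
Qed.

Lemma agree_setU1 s : agree (y |: D) s = agree D s && (d s y == r y).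
Proof.
apply/forall_inP/andP => [H|[/forall_inP H /eqP Hy] i].
  split; last by apply: H; rewrite !inE eqxx.
  by apply/forall_inP => i iD; apply: H; rewrite !inE iD orbT.
by rewrite !inE => /orP[/eqP->|/H //]; rewrite Hy.
Qed.

Lemma coef_var_poly x : (var_poly D y a x)`_(r y) = coef_part (y |: D) a x.
Proof.
rewrite coef_sum [RHS](eq_bigl _ _ agree_setU1) [RHS]big_mkcondr.
apply: eq_bigr => s _; rewrite coefZ coefXn eq_sym.
by case: eqP; rewrite ?mulr1 ?mulr0.
Qed.

Lemma sum_notin s : agree D s -> a s != 0 ->
  (\sum_(i | i \notin D) d s i = rest D)%N.
Proof.
move=> /forall_inP agr /homog; rewrite /rest (bigID (mem D)) /= => <-.
have -> : (\sum_(i in D) d s i = \sum_(i in D) r i)%N.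
  by apply: eq_bigr => i iD; exact/eqP/agr.
by rewrite addKn.
Qed.

Lemma sum_notin_setU1 s : agree D s -> a s != 0 ->
  (d s y + \sum_(i | i \notin y |: D) d s i = rest D)%N.
Proof.
move=> agr /(sum_notin agr); rewrite (bigD1 y) //= => <-; congr (_ + _)%N.
by apply: eq_bigl => i; rewrite !inE negb_or andbC.
Qed.

Lemma coef_part_scale x l :
  coef_part D a (fun i => l * x i) = l ^+ rest D * coef_part D a x.
Proof.
rewrite mulr_sumr; apply: eq_bigr => s agr.
have [->|a0] := eqVneq (a s) 0; first by rewrite !mul0r mulr0.
under eq_bigr do rewrite exprMn.
by rewrite big_split /= prodrXr sum_notin // mulrCA.
Qed.

Lemma size_var_poly x : coef_part D a (fun i => (i == y)%:R) != 0 ->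
  size (var_poly D y a x) = (rest D).+1.
Proof.
move=> nz; apply/eqP; rewrite eqn_leq; apply/andP; split.
  apply: (leq_trans (size_sum _ _ _)); apply/bigmax_leqP => s agr.
  have [->|a0] := eqVneq (a s) 0; first by rewrite mul0r scale0r size_poly0.
  rewrite (leq_trans (size_scale_leq _ _)) // size_polyXn ltnS.
  by rewrite -(sum_notin_setU1 agr a0) leq_addr.
rewrite ltnNge; apply: contraNN nz => /leq_sizeP/(_ _ (leqnn _)) E.
rewrite -E coef_sum; apply/eqP; apply: eq_bigr => s agr.
rewrite coefZ coefXn; have [->|a0] := eqVneq (a s) 0; first by rewrite !mul0r.
rewrite prod_notin_setU1 eqxx expr1n mul1r -mulrA; congr (_ * _).
have := sum_notin_setU1 agr a0.
have [E1|/eqP E1] := eqVneq (rest D) (d s y); last first.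
  rewrite mulr0 => E2.
  have [i /andP[iD di]|H] := pickP [pred i | (i \notin y |: D) && (d s i != 0%N)].
    rewrite (bigD1 i) //= [i == y]negbTE ?expr0n ?(negPf di) ?mul0r //.
    by apply: contraNN iD => /eqP ->; rewrite !inE eqxx.
  rewrite big1 ?addn0 in E2 => [|i iD]; first by rewrite E2 in E1.
  by have := H i; rewrite /= iD => /negbFE/eqP.
rewrite E1 mulr1 -{2}[d s y]addn0 => /addnI/eqP; rewrite sum_nat_eq0 => /forall_inP d0.
by apply: eq_bigr => i iD; rewrite (eqP (d0 i iD)) !expr0.
Qed.

End Ring.

Section Stable.
Variables (F : realType) (a : S -> F).
Hypothesis a_ge0 : forall s, 0 <= a s.
Hypothesis homog : forall s, a s != 0 -> (\sum_i d s i = N)%N.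
Hypothesis sum_r : (\sum_i r i = N)%N.

Let aC (s : S) : F[i] := real_complex F (a s).

Let homogC s : aC s != 0 -> (\sum_i d s i = N)%N.
Proof. by move=> aC0; apply: homog; apply: contraNneq aC0; rewrite /aC => ->. Qed.

Definition stable_part (D : {set I}) := forall x : I -> F[i],
  (forall i, i \notin D -> 0 <= complex.Re (x i)) ->
  (exists2 i, i \notin D & 0 < complex.Re (x i)) -> coef_part D aC x != 0.

Lemma rest_setU1 (D : {set I}) y : y \notin D ->
  rest D = (r y + rest (y |: D))%N.
Proof.
move=> yD; have : (\sum_(i in y |: D) r i <= N)%N.
  by rewrite -sum_r [leqRHS](bigID (mem (y |: D))) leq_addr.
by rewrite /rest big_setU1 //=; lia.
Qed.

Lemma stable_delta (D : {set I}) y : y \notin D -> stable_part D ->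
  coef_part D aC (fun i => (i == y)%:R) != 0.
Proof.
move=> yD; apply=> [i _|]; first by case: eqP; rewrite /= ?ler01.
by exists y; rewrite // eqxx /= ltr01.
Qed.

Lemma stable_setU1 (D : {set I}) y : y \notin D -> stable_part D ->
  stable_part (y |: D).
Proof.
move=> yD stD x x0 [j jD xj]; rewrite -coef_var_poly; apply: hurwitz_coef.
  move=> z z0; rewrite horner_var_poly //; apply: stD => [i iD|].
    rewrite /set_var; case: (eqVneq i y) => // iy; apply: x0.
    by rewrite !inE negb_or iy.
  exists j; first by apply: contraNN jD => jD; rewrite !inE jD orbT.
  by rewrite /set_var ifN //; apply: contraNN jD => /eqP ->; rewrite !inE eqxx.
by rewrite (size_var_poly homogC) ?stable_delta // ltnS (rest_setU1 yD) leq_addr.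
Qed.

Let xC (x : I -> F) (i : I) : F[i] := real_complex F (x i).

Lemma map_var_poly (D : {set I}) y x :
  map_poly (real_complex F) (var_poly D y a x) = var_poly D y aC (xC x).
Proof.
rewrite rmorph_sum /=; apply: eq_bigr => s _.
rewrite map_polyZ map_polyXn; congr (_ *: _).
rewrite rmorphM rmorph_prod; congr (_ * _).
by apply: eq_bigr => i _; rewrite rmorphXn.
Qed.

(* A root z off the negative real axis could be rotated, together with the positive x,
   into the closed right half-plane by homogeneity. *)
Lemma var_poly_roots (D : {set I}) y j x : y \notin D -> stable_part D ->
  j \notin y |: D -> (forall i, 0 < x i) ->
  exists s : seq F, [/\ all (fun t => 0 < t) s, size s = rest D &
    var_poly D y a x = lead_coef (var_poly D y a x) *: \prod_(t <- s) ('X + t%:P)].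
Proof.
move=> yD stD jD x0; set p := var_poly D y a x.
have jy : j != y by apply: contraNneq jD => ->; rewrite !inE eqxx.
have jD' : j \notin D by apply: contraNN jD => jD; rewrite !inE jD orbT.
have sz : size (map_poly (real_complex F) p) = (rest D).+1.
  by rewrite map_var_poly (size_var_poly homogC) ?stable_delta.
have [zs pE] := closed_field_poly_normal (map_poly (real_complex F) p).
have lc : lead_coef (map_poly (real_complex F) p) != 0.
  by rewrite lead_coef_eq0 -size_poly_eq0 sz.
have zsP z : z \in zs -> complex.Re z < 0 /\ complex.Im z = 0.
  rewrite -root_prod_XsubC => pz.
  have : coef_part D aC (set_var (xC x) y z) = 0.
    rewrite -horner_var_poly // -map_var_poly -/p pE hornerZ.
    by move/rootP: pz => ->; rewrite mulr0.
  move=> pz0; have Rez : complex.Re z < 0.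
    rewrite ltNge; apply/negP => Rez; move/eqP: pz0; apply/negP; apply: stD => [i _|].
      by rewrite /set_var; case: ifP => // _; rewrite /= ltW.
    by exists j => //; rewrite /set_var (negPf jy) /=.
  split=> //; apply/eqP/negPn/negP => Imz.
  pose l : F[i] := Complex 1 (complex.Re z / complex.Im z).
  have E0 : coef_part D aC (fun i => l * set_var (xC x) y z i) = 0.
    by rewrite (coef_part_scale homogC) pz0 mulr0.
  have Rel u : complex.Re (l * real_complex F u) = u.
    by rewrite /= mulr0 subr0 mul1r.
  have Relz : complex.Re (l * z) = 0.
    by rewrite /l; case: (z) Imz => u v /= v0; rewrite divfK // mul1r subrr.
  move/eqP: E0; apply/negP; apply: stD => [i _|].
    by rewrite /set_var; case: ifP => _; rewrite ?Relz // Rel ltW.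
  by exists j => //; rewrite /set_var (negPf jy) Rel.
exists [seq - complex.Re z | z <- zs]; split.
- by apply/allP => _ /mapP[z /zsP[Rez _] ->]; rewrite oppr_gt0.
- rewrite size_map; move: sz; rewrite pE size_scale // size_prod_XsubC.
  by case.
apply: (map_poly_inj (real_complex F)); rewrite [LHS]pE map_polyZ lead_coef_map.
congr (_ *: _); rewrite rmorph_prod big_map; apply: eq_big_seq => z /zsP[_ Imz].
rewrite rmorphD /= map_polyX map_polyC /= -polyCN; congr (_ + _%:P).
by case: z Imz => u v /= ->; rewrite /real_complex_def; congr Complex; rewrite ?oppr0.
Qed.

Lemma coef_part_ge (D : {set I}) (kappa : F) : 0 <= kappa -> stable_part finset.set0 ->
  (forall x : I -> F, (forall i, 0 < x i) -> kappa * \prod_i x i ^+ r i <=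
     coef_part finset.set0 a x) ->
  stable_part D /\ forall x : I -> F, (forall i, 0 < x i) ->
  kappa * ((\prod_(i in D) omega F (r i)) * omega F (rest D) / omega F N) *
    \prod_(i | i \notin D) x i ^+ r i <= coef_part D a x.
Proof.
move=> k0 st0 H0.
move: {2}#|D| (erefl #|D|) => k; elim: k D => [|k IH] D cD.
  rewrite (cards0_eq cD); split=> // x x0; apply: le_trans (H0 x x0).
  rewrite big_set0 mul1r /rest big_set0 subn0 divff ?mulr1 ?gt_eqF ?omega_gt0 //.
  by rewrite (eq_bigl xpredT) // => i; rewrite inE.
have [y yD] : exists y, y \in D by apply/set0Pn; rewrite -card_gt0 cD.
have [|st H] := IH (D :\ y).
  by rewrite cardsDS ?finset.sub1set // cD cards1 subn1.
have yD' : y \notin D :\ y by rewrite !inE eqxx.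
rewrite -(finset.setD1K yD); split=> [|x x0]; first exact: stable_setU1.
set D' := D :\ y in st H yD' *.
set cst := \prod_(i in D') omega F (r i) * omega F (rest D') / omega F N in H.
have -> : \prod_(i in y |: D') omega F (r i) * omega F (rest (y |: D')) / omega F N =
    cst * (omega F (r y) * omega F (rest D' - r y) / omega F (rest D')).
  rewrite (rest_setU1 yD') addKn -(rest_setU1 yD') big_setU1 //= /cst.
  have oD : omega F (rest D') != 0 by rewrite gt_eqF ?omega_gt0.
  have oN : omega F N != 0 by rewrite gt_eqF ?omega_gt0.
  move: (omega F (rest D')) (omega F N) oD oN => u v u0 v0.
  by field; rewrite u0 v0.
have cst0 : 0 <= cst.
  have [oD oN] := (omega_gt0 F (rest D'), omega_gt0 F N).
  rewrite ltW // divr_gt0 // mulr_gt0 // prodr_gt0 // => i _; exact: omega_gt0.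
have [j jD|noj] := pickP [pred i | i \notin y |: D'].
  have [s [s0 sz pE]] := var_poly_roots yD' st jD x0.
  rewrite -coef_var_poly // pE coefZ.
  pose mx := \prod_(i | i \notin y |: D') x i ^+ r i.
  have mx0 : 0 <= mx by rewrite prodr_ge0 // => i _; rewrite exprn_ge0 // ltW.
  have := @capacity_roots F s (lead_coef (var_poly D' y a x)) (kappa * cst * mx) (r y) s0.
  rewrite sz => C.
  have -> (u : F) : kappa * (cst * u) * mx = kappa * cst * mx * u by ring.
  apply: C.
  - rewrite /lead_coef coef_sum sumr_ge0 // => t _; rewrite coefZ coefXn.
    rewrite !mulr_ge0 // prodr_ge0 // => i _; rewrite exprn_ge0 // ltW //.
  - by rewrite mulr_ge0 // mulr_ge0.
  - by rewrite (rest_setU1 yD') leq_addr.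
  move=> t t0; rewrite -hornerZ -pE horner_var_poly //.
  have := H (set_var x y t) _; rewrite (prod_notin_setU1 yD').
  have -> : \prod_(i | i \notin y |: D') set_var x y t i ^+ r i = mx.
    apply: eq_bigr => i iD; rewrite /set_var ifN //.
    by apply: contraNN iD => /eqP ->; rewrite !inE eqxx.
  have -> : set_var x y t y = t by rewrite /set_var eqxx.
  rewrite [t ^+ _ * _]mulrC mulrA; apply=> i.
  by rewrite /set_var; case: ifP.
have ryE : rest D' = r y.
  rewrite (rest_setU1 yD') /rest; have -> : (\sum_(i in y |: D') r i = N)%N.
    rewrite -sum_r; apply: eq_bigl => i; have := noj i.
    by rewrite /= => /negbFE ->.
  by rewrite subnn addn0.
have := H (fun=> 1) (fun=> ltr01).
rewrite big1 => [|i _]; last by rewrite expr1n.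
rewrite big_pred0 // ryE subnn.
have -> : omega F 0 = 1 by rewrite /omega expr0 fact0 divr1.
rewrite !mulr1 divff ?gt_eqF ?omega_gt0 // mulr1 => /le_trans; apply.
rewrite /coef_part [leRHS](eq_bigl _ _ (agree_setU1 D' y)) [leRHS]big_mkcondr.
apply: ler_sum => s agr.
have [->|a0] := eqVneq (a s) 0; first by rewrite !mul0r; case: ifP.
have := sum_notin_setU1 homog yD' agr a0; rewrite big_pred0 // addn0 ryE => ->.
rewrite eqxx [X in _ <= _ * X]big_pred0 // big1 // => i _; exact: expr1n.
Qed.

(* The van der Waerden bound in Gurvits' form. *)
Lemma capacity_coef (kappa : F) : 0 <= kappa -> stable_part finset.set0 ->
  (forall x : I -> F, (forall i, 0 < x i) -> kappa * \prod_i x i ^+ r i <=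
     \sum_s a s * \prod_i x i ^+ d s i) ->
  kappa * ((\prod_i omega F (r i)) / omega F N) <=
    \sum_(s | [forall i, d s i == r i]) a s.
Proof.
move=> k0 st H.
have [_ /(_ (fun=> 1) (fun=> ltr01))] := @coef_part_ge finset.setT kappa k0 st
  (fun x x0 => eq_ind_r (fun u => _ <= u) (H x x0) (coef_part0 a x)).
rewrite [X in _ * X <= _]big_pred0 ?mulr1 => [|i]; last by rewrite inE.
rewrite /rest [X in (N - X)%N](_ : _ = N) ?subnn; last first.
  by rewrite -sum_r; apply: eq_bigl => i; rewrite inE.
have -> : omega F 0 = 1 by rewrite /omega expr0 fact0 divr1.
rewrite mulr1; congr (_ * (_ / _) <= _).
  by apply: eq_bigl => i; rewrite inE.
apply: eq_big => [s|s _].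
  by apply/forall_inP/forallP => h i; [apply: h; rewrite inE|].
by rewrite big_pred0 ?mulr1 // => i; rewrite inE.
Qed.

End Stable.

End Elimination.

(** * Generating functions of tables *)

Lemma multinomial (R : numFieldType) (I : finType) (y : I -> R) B c : (c < B)%N ->
  \sum_(a : {ffun I -> 'I_B} | (\sum_i a i == c)%N) \prod_i (y i ^+ a i / (a i)`!%:R) =
  (\sum_i y i) ^+ c / c`!%:R.
Proof.
move=> cB; pose E i : {poly R} := \sum_(k < B) (y i ^+ k / k`!%:R) *: 'X^k.
have EE i k : (k < B)%N -> (E i)`_k = y i ^+ k / k`!%:R.
  move=> kB; have -> : E i = \poly_(k < B) (y i ^+ k / k`!%:R) by rewrite poly_def.
  by rewrite coef_poly kB.
have f0 k : k`!%:R != 0 :> R by rewrite pnatr_eq0 -lt0n fact_gt0.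
transitivity ((\prod_i E i)`_c).
  rewrite bigA_distr_bigA /= coef_sum big_mkcond; apply: eq_bigr => a _.
  rewrite [in RHS]scaler_prod [in RHS]prodrXr coefZ coefXn eq_sym.
  by case: eqP; rewrite ?mulr1 ?mulr0.
move: (index_enum I) => s; elim: s c cB => [|i s IH] c cB.
  rewrite !big_nil coef1; case: c cB => [|c] _; first by rewrite expr0 fact0 divr1.
  by rewrite expr0n mul0r.
rewrite !big_cons mulrC coefM addrC exprDn mulr_suml.
rewrite (reindex_inj rev_ord_inj) /=; apply: eq_bigr => k _.
have kc : (k <= c)%N by rewrite -ltnS.
rewrite !subSS subKn // IH; last by rewrite (leq_ltn_trans _ cB) ?leq_subr.
rewrite EE; last by rewrite (leq_ltn_trans _ cB).
rewrite -mulr_natr -(bin_fact kc) !natrM.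
have b0 : 'C(c, k)%:R != 0 :> R by rewrite pnatr_eq0 -lt0n bin_gt0.
by field; rewrite b0 !f0.
Qed.

Section Tables.
Variables (I J : finType) (B : nat).
Local Notation table := {ffun J -> {ffun I -> 'I_B}}.
Implicit Types (r : I -> nat) (c : J -> nat) (A : table).

Definition has_rows r A := [forall i, (\sum_j A j i)%N == r i].
Definition has_cols c A := [forall j, (\sum_i A j i)%N == c j].

Definition table_wt (R : numFieldType) (w : I -> J -> R) A : R :=
  \prod_j \prod_i (w i j ^+ A j i / (A j i)`!%:R).

(* The coefficient of x^r in [col_prod]. *)
Definition table_coef (R : numFieldType) (w : I -> J -> R) r c : R :=
  \sum_(A | has_rows r A && has_cols c A) table_wt w A.

Definition col_prod (R : numFieldType) (w : I -> J -> R) c (x : I -> R) : R :=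
  \prod_j ((\sum_i w i j * x i) ^+ c j / (c j)`!%:R).

Lemma sum_has_cols (R : comPzSemiRingType) (g : J -> {ffun I -> 'I_B} -> R) c :
  \sum_(A | has_cols c A) \prod_j g j (A j) =
  \prod_j \sum_(a : {ffun I -> 'I_B} | (\sum_i a i == c j)%N) g j a.
Proof.
rewrite bigA_distr_big_dep; apply: eq_bigl => A.
apply/forallP/familyP => H j; first exact: H.
exact: H.
Qed.

Lemma col_prod_expand (R : numFieldType) (w : I -> J -> R) c x :
  (forall j, c j < B)%N ->
  col_prod w c x = \sum_(A | has_cols c A) table_wt w A * \prod_i x i ^+ (\sum_j A j i).
Proof.
move=> cB; rewrite /col_prod.
under eq_bigr => j _ do rewrite -(multinomial _ (cB j)).
rewrite -sum_has_cols; apply: eq_bigr => A _.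
under [X in _ * X]eq_bigr do rewrite -prodrXr.
rewrite /table_wt.
rewrite [X in _ * X]exchange_big -big_split /=; apply: eq_bigr => j _.
rewrite -big_split; apply: eq_bigr => i _ /=.
by rewrite exprMn mulrAC.
Qed.

Lemma sum_has_rows (R : comPzSemiRingType) (g : I -> J -> 'I_B -> R) r :
  \sum_(A | has_rows r A) \prod_j \prod_i g i j (A j i) =
  \prod_i \sum_(a : {ffun J -> 'I_B} | (\sum_j a j == r i)%N) \prod_j g i j (a j).
Proof.
rewrite bigA_distr_big_dep.
pose tr (A : {ffun I -> {ffun J -> 'I_B}}) : table := [ffun j => [ffun i => A i j]].
pose rt (A : table) := [ffun i => [ffun j => A j i]] : {ffun I -> {ffun J -> 'I_B}}.
rewrite (reindex tr) /=; last first.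
  exists rt => A _; apply/ffunP => u; apply/ffunP => v; by rewrite !ffunE.
apply: eq_big => [A|A _].
  apply/forallP/familyP => H i; have := H i; rewrite ?inE.
    by under eq_bigr do rewrite !ffunE.
  by under [in X in _ -> X]eq_bigr do rewrite !ffunE.
rewrite exchange_big; apply: eq_bigr => i _; apply: eq_bigr => j _.
by rewrite !ffunE.
Qed.

Lemma table_wt_ge0 (R : numFieldType) (w : I -> J -> R) A :
  (forall i j, 0 <= w i j) -> 0 <= table_wt w A.
Proof.
move=> w0; apply: prodr_ge0 => j _; apply: prodr_ge0 => i _.
by rewrite divr_ge0 ?exprn_ge0.
Qed.

Lemma table_coef_ge0 (R : numFieldType) (w : I -> J -> R) r c :
  (forall i j, 0 <= w i j) -> 0 <= table_coef w r c.
Proof. by move=> w0; apply: sumr_ge0 => A _; exact: table_wt_ge0. Qed.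

Section Bounds.
Variables (F : realType) (w : I -> J -> F) (r : I -> nat) (c : J -> nat).
Hypotheses (w_gt0 : forall i j, 0 < w i j) (c_lt : forall j, (c j < B)%N).

Let w_ge0 i j : 0 <= w i j. Proof. exact: ltW. Qed.

Lemma table_coef_le_col_prod x : (forall i, 0 < x i) ->
  table_coef w r c * \prod_i x i ^+ r i <= col_prod w c x.
Proof.
move=> x0; rewrite col_prod_expand // mulr_suml [leRHS]big_mkcond [leLHS]big_mkcond.
apply: ler_sum => A _; case: (has_cols c A); rewrite ?andbF // andbT.
case: ifP => [/forallP Hr|_].
  by rewrite (eq_bigr (fun i => x i ^+ (\sum_j A j i))) // => i _; rewrite (eqP (Hr i)).
rewrite mulr_ge0 ?table_wt_ge0 // prodr_ge0 // => i _.
by rewrite exprn_ge0 // ltW.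
Qed.

Hypotheses (r_lt : forall i, (r i < B)%N) (sum_rc : (\sum_i r i = \sum_j c j)%N).

(* Dropping the column constraints, after rescaling the columns to the sums c. *)
Lemma table_coef_le_omega (i0 : I) x : (forall i, 0 < x i) ->
  table_coef w r c * \prod_i x i ^+ r i <=
    (\prod_i omega F (r i)) / (\prod_j omega F (c j)) * col_prod w c x.
Proof.
move=> x0; pose l j := \sum_i w i j * x i.
have l0 j : 0 < l j.
  rewrite /l (bigD1 i0) //= ltr_pwDl ?mulr_gt0 // sumr_ge0 // => i _.
  by rewrite mulr_ge0 // ltW.
pose u i j := w i j * x i * ((c j)%:R / l j).
have u0 i j : 0 <= u i j by rewrite !mulr_ge0 ?invr_ge0 // ltW.
have scale : table_coef u r c =
    table_coef w r c * (\prod_i x i ^+ r i) * \prod_j ((c j)%:R / l j) ^+ c j.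
  rewrite /table_coef !mulr_suml; apply: eq_bigr => A /andP[/forallP Hr /forallP Hc].
  rewrite (eq_bigr (fun i => \prod_j x i ^+ A j i)) => [|i _]; last first.
    by rewrite prodrXr (eqP (Hr i)).
  rewrite exchange_big -!big_split; apply: eq_bigr => j _ /=.
  rewrite -{2}(eqP (Hc j)) -prodrXr -!big_split; apply: eq_bigr => i _ /=.
  by rewrite /u !exprMn; ring.
have u_le : table_coef u r c <= \prod_i omega F (r i).
  apply: (@le_trans _ _ (\sum_(A | has_rows r A) table_wt u A)).
    rewrite [leRHS]big_mkcond [leLHS]big_mkcond; apply: ler_sum => A _.
    by case: (has_rows r A); rewrite //=; case: ifP => // _; exact: table_wt_ge0.
  rewrite (sum_has_rows (fun i j k => u i j ^+ k / k`!%:R)).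
  under eq_bigr => i _ do rewrite multinomial //.
  rewrite /omega !big_split /= ler_wpM2r //.
    by apply: prodr_ge0 => i _; rewrite invr_ge0.
  apply: gibbs => [i|]; first exact: sumr_ge0.
  rewrite exchange_big -natr_sum sum_rc natr_sum; apply: eq_bigr => j _.
  by rewrite /u -mulr_suml -/(l j) mulrC divfK // gt_eqF.
have P0 : 0 < \prod_j ((c j)%:R / l j) ^+ c j :> F.
  apply: prodr_gt0 => j _; case: (posnP (c j)) => [->|cj]; first by rewrite expr0.
  by rewrite exprn_gt0 // divr_gt0 // ltr0n.
have -> : col_prod w c x =
    \prod_j omega F (c j) / \prod_j ((c j)%:R / l j) ^+ c j.
  apply: (mulIf (lt0r_neq0 P0)); rewrite divfK ?(lt0r_neq0 P0) // -big_split.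
  apply: eq_bigr => j _ /=; rewrite -/(l j) /omega expr_div_n.
  have lj : l j ^+ c j != 0 by rewrite expf_neq0 // gt_eqF.
  have f0 : (c j)`!%:R != 0 :> F by rewrite pnatr_eq0 -lt0n fact_gt0.
  by field; rewrite lj f0.
have C0 : \prod_j omega F (c j) != 0.
  by apply/prodf_neq0 => j _; rewrite gt_eqF ?omega_gt0.
by rewrite mulrA divfK // ler_pdivlMr // -scale.
Qed.

Lemma table_coef_ge (kappa : F) : 0 <= kappa ->
  (forall x, (forall i, 0 < x i) -> kappa * \prod_i x i ^+ r i <= col_prod w c x) ->
  kappa * (\prod_i omega F (r i) / omega F (\sum_j c j)) <= table_coef w r c.
Proof.
move=> k0 H.
pose a A := if has_cols c A then table_wt w A else 0.
have aE (R : numFieldType) (g : F -> R) (x : I -> R) : g 0 = 0 ->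
    \sum_A g (a A) * \prod_i x i ^+ (\sum_j A j i) =
    \sum_(A | has_cols c A) g (table_wt w A) * \prod_i x i ^+ (\sum_j A j i).
  move=> g0; rewrite [RHS]big_mkcond; apply: eq_bigr => A _.
  by rewrite /a; case: ifP; rewrite // g0 mul0r.
have a0 A : 0 <= a A by rewrite /a; case: ifP => // _; exact: table_wt_ge0.
have homog A : a A != 0 -> (\sum_i \sum_j A j i = \sum_j c j)%N.
  rewrite /a; case: ifP => [/forallP Hc _|]; last by rewrite eqxx.
  by rewrite exchange_big; apply: eq_bigr => j _; exact/eqP.
have := @capacity_coef I _ (fun A i => (\sum_j A j i)%N) r _ F a a0 homog sum_rc kappa k0.
rewrite [X in _ <= X](_ : _ = table_coef w r c); last first.
  by rewrite /table_coef [RHS]big_mkcondr.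
apply; last first.
  by move=> x x0; rewrite (aE _ idfun) // -col_prod_expand // H.
move=> x x0 [i _ xi].
rewrite coef_part0 (aE _ (real_complex F)) //.
pose wC i j := real_complex F (w i j).
have -> : \sum_(A | has_cols c A) real_complex F (table_wt w A) *
    \prod_i x i ^+ (\sum_j A j i) = col_prod wC c x.
  rewrite col_prod_expand //; apply: eq_bigr => A _; congr (_ * _).
  rewrite rmorph_prod; apply: eq_bigr => j _.
  rewrite rmorph_prod; apply: eq_bigr => y _.
  by rewrite fmorph_div rmorphXn rmorph_nat.
apply/prodf_neq0 => j _; rewrite mulf_neq0 ?invr_eq0 ?pnatr_eq0 -?lt0n ?fact_gt0 //.
rewrite expf_neq0 //.
have Rew y : complex.Re (wC y j * x y) = w y j * complex.Re (x y).
  by case: (x y) => p q /=; rewrite mul0r subr0.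
have : 0 < complex.Re (\sum_y wC y j * x y).
  have ReS (h : I -> F[i]) : complex.Re (\sum_y h y) = \sum_y complex.Re (h y).
    by apply: (big_morph _ (@ReD F)).
  rewrite ReS (bigD1 i) //= ltr_pwDl ?Rew ?mulr_gt0 // sumr_ge0 // => y _.
  by rewrite Rew mulr_ge0 // x0 // inE.
by apply: contraTneq => ->; rewrite ltxx.
Qed.

End Bounds.

End Tables.

(** * Log-concavity for weighted tables *)

Section Weighted.
Variables (F : realType) (n : nat) (alpha : 'I_n -> F).
Hypotheses (alpha_ge0 : forall t, 0 <= alpha t) (alpha_sum : \sum_t alpha t = 1).
Variables (I J : finType) (i0 : I) (B : nat).
Variables (r_ : 'I_n -> I -> nat) (r : I -> nat) (c : J -> nat).
Hypotheses (r_lt : forall t i, (r_ t i < B)%N) (c_lt : forall j, (c j < B)%N).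
Hypothesis sum_rc : forall t, (\sum_i r_ t i = \sum_j c j)%N.
Hypothesis rE : forall i, (r i)%:R = \sum_t alpha t * (r_ t i)%:R.

Let om (T : finType) (v : T -> nat) : F := \prod_i omega F (v i).
Let mn t := Num.min (om (r_ t)) (om c).
Let N := (\sum_j c j)%N.

Let om_gt0 (T : finType) (v : T -> nat) : 0 < om v.
Proof. by apply: prodr_gt0 => i _; exact: omega_gt0. Qed.

Let mn_gt0 t : 0 < mn t. Proof. by rewrite lt_min !om_gt0. Qed.

Let sum_r : (\sum_i r i = N)%N.
Proof.
apply/eqP; rewrite -(eqr_nat F) natr_sum; apply/eqP.
under eq_bigr do rewrite rE; rewrite exchange_big /=.
under eq_bigr => t _ do rewrite -mulr_sumr -natr_sum sum_rc.
by rewrite -mulr_suml alpha_sum mul1r.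
Qed.

Lemma col_prod_concave (g : 'I_n -> I -> J -> F) x :
  (forall t i j, 0 < g t i j) -> (forall i, 0 < x i) ->
  \prod_t col_prod (g t) c x `^ alpha t <=
  col_prod (fun i j => \sum_t alpha t * g t i j) c x.
Proof.
move=> g0 x0; pose l t j := \sum_i g t i j * x i.
have l0 t j : 0 < l t j.
  rewrite /l (bigD1 i0) //= ltr_pwDl ?mulr_gt0 // sumr_ge0 // => i _.
  by rewrite mulr_ge0 // ltW.
have f0 j : 0 < (c j)`!%:R^-1 :> F by rewrite invr_gt0 ltr0n fact_gt0.
under eq_bigr => t _.
  rewrite /col_prod powR_prod; last first.
    by move=> j _; rewrite mulr_ge0 ?exprn_ge0 // ltW // l0.
  over.
rewrite exchange_big /=; apply: ler_prod => j _.
apply/andP; split; first by apply: prodr_ge0 => t _; exact: powR_ge0.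
under eq_bigr => t _ do rewrite powRM ?exprn_ge0 ?(ltW (f0 j)) ?(ltW (l0 t j)) //.
rewrite big_split /= -powR_sum // alpha_sum powRr1 ?(ltW (f0 j)) // ler_pM2r //.
have -> : \sum_i (\sum_t alpha t * g t i j) * x i = \sum_t alpha t * l t j.
  under eq_bigr do rewrite mulr_suml.
  rewrite exchange_big; apply: eq_bigr => t _; rewrite mulr_sumr.
  by apply: eq_bigr => i _; rewrite mulrA.
rewrite (eq_bigr (fun t => (l t j `^ alpha t) ^+ c j)) => [|t _]; last first.
  by rewrite -[l t j ^+ c j]powR_mulrn ?(ltW (l0 t j)) // powRAC powR_mulrn ?powR_ge0.
have AM := amgm alpha_ge0 alpha_sum (fun t => l0 t j).
have P0 : 0 <= \prod_t l t j `^ alpha t by apply: prodr_ge0 => t _; exact: powR_ge0.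
by rewrite prodrXl lerXn2r // nnegrE (le_trans P0 AM).
Qed.

Lemma table_coef_log_concave (g : 'I_n -> I -> J -> F) : (forall t i j, 0 < g t i j) ->
  \prod_t (table_coef B (g t) (r_ t) c / mn t) `^ alpha t <=
  omega F N / (om r * om c) *
    table_coef B (fun i j => \sum_t alpha t * g t i j) r c.
Proof.
move=> g0; set L := \prod_t _.
have q0 t : 0 <= table_coef B (g t) (r_ t) c / mn t.
  rewrite mulr_ge0 ?invr_ge0 ?(ltW (mn_gt0 t)) //.
  by apply: table_coef_ge0 => i j; exact: ltW.
have L0 : 0 <= L by apply: prodr_ge0 => t _; exact: powR_ge0.
have conv0 i j : 0 < \sum_t alpha t * g t i j.
  exact: (conv_gt0 alpha_ge0 alpha_sum).
have := @table_coef_ge I J B F _ r c conv0 c_lt sum_r (om c * L).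
rewrite mulr_ge0 ?(ltW (om_gt0 c)) // => /(_ isT) H.
suff H1 : om c * L * (om r / omega F N) <=
    table_coef B (fun i j => \sum_t alpha t * g t i j) r c.
  have z0 : 0 < om c * (om r / omega F N).
    apply: mulr_gt0; first exact: om_gt0.
    by apply: divr_gt0; [exact: om_gt0|exact: omega_gt0].
  have -> : omega F N / (om r * om c) = (om c * (om r / omega F N))^-1.
    by rewrite [in LHS]invfM [in RHS]invfM invf_div mulrA [RHS]mulrC.
  by rewrite mulrC ler_pdivlMr // mulrC mulrAC.
apply: H => x x0.
apply: le_trans (col_prod_concave g0 x0).
have -> : \prod_i x i ^+ r i = \prod_t (\prod_i x i ^+ r_ t i) `^ alpha t.
  rewrite (eq_bigr (fun i => \prod_t x i `^ (alpha t * (r_ t i)%:R))) => [|i _].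
    rewrite exchange_big; apply: eq_bigr => t _ /=.
    rewrite powR_prod => [|i _]; last by rewrite exprn_ge0 // ltW.
    apply: eq_bigr => i _; rewrite mulrC powRrM powR_mulrn // ltW //.
  by rewrite -powR_mulrn ?ltW // rE powR_sum.
have -> : om c = \prod_t om c `^ alpha t.
  by rewrite -powR_sum // alpha_sum powRr1 // ltW.
rewrite /L -!big_split /=; apply: ler_prod => t _.
have X0 : 0 <= \prod_i x i ^+ r_ t i.
  by apply: prodr_ge0 => i _; rewrite exprn_ge0 // ltW.
have omc0 := ltW (om_gt0 c); have omq0 := mulr_ge0 omc0 (q0 t).
rewrite -!powRM // powR_ge0 /=.
have U1 := table_coef_le_col_prod (r_ t) (g0 t) c_lt x0.
have U2 := table_coef_le_omega (g0 t) (r_lt t) (sum_rc t) i0 x0.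
have C0 : 0 <= table_coef B (g t) (r_ t) c by apply: table_coef_ge0 => i j; exact: ltW.
have lhs0 := mulr_ge0 omq0 X0.
have rhs0 := le_trans (mulr_ge0 C0 X0) U1.
apply: ge0_ler_powR => //.
rewrite mulrA mulrAC ler_pdivrMr // -mulrA.
have [R0 C1] := conj (om_gt0 (r_ t)) (om_gt0 c).
rewrite /mn; have [rc|cr] := leP (om (r_ t)) (om c).
  rewrite -ler_pdivlMl //; apply: le_trans U2 _.
  by rewrite le_eqVlt; apply/orP; left; apply/eqP; rewrite -/(om _) -/(om c); ring.
by rewrite mulrC ler_pM2r.
Qed.

Definition table_sum (w : I -> J -> F) (v : I -> nat) (c' : J -> nat) : F :=
  \sum_(A : {ffun J -> {ffun I -> 'I_B}} | has_rows v A && has_cols c' A)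
    \prod_j \prod_i w i j ^+ A j i.

Lemma table_sum_ineq (w : I -> J -> F) : (forall i j, 0 < w i j) ->
  \prod_t (table_sum w (r_ t) c / mn t) `^ alpha t <=
  omega F N / (om r * om c) * table_sum w r c.
Proof.
move=> w0; pose S : finType := {ffun J -> {ffun I -> 'I_B}}.
pose d (A : S) (e : I * J) : nat := A e.2 e.1.
pose a v (A : S) : F := if has_rows v A && has_cols c A then table_wt w A else 0.
have a0 v A : 0 <= a v A.
  by rewrite /a; case: ifP => // _; apply: table_wt_ge0 => i j; exact: ltW.
have pairE (h : J -> I -> F) : \prod_(e : I * J) h e.2 e.1 = \prod_j \prod_i h j i.
  by rewrite -(pair_bigA _ (fun i j => h j i)) exchange_big.
have laplaceE v k : \sum_A k * a v A * \prod_e (d A e)`!%:R = k * table_sum w v c.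
  rewrite mulr_sumr [RHS]big_mkcond; apply: eq_bigr => A _.
  rewrite /a; case: ifP => // _; last by rewrite mulr0 mul0r.
  rewrite (pairE (fun j i => (A j i)`!%:R)) -mulrA -big_split; congr (_ * _).
  apply: eq_bigr => j _; rewrite -big_split; apply: eq_bigr => i _ /=.
  by rewrite divfK // pnatr_eq0 -lt0n fact_gt0.
have coefE v k g : \sum_A k * a v A * \prod_e g e ^+ d A e =
    k * table_coef B (fun i j => w i j * g (i, j)) v c.
  rewrite mulr_sumr [RHS]big_mkcond; apply: eq_bigr => A _.
  rewrite /a; case: ifP => // _; last by rewrite mulr0 mul0r.
  rewrite (eq_bigr (fun e : I * J => g (e.1, e.2) ^+ A e.2 e.1)) => [|[] //].
  rewrite (pairE (fun j i => g (i, j) ^+ A j i)) -mulrA -big_split; congr (_ * _).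
  apply: eq_bigr => j _; rewrite -big_split; apply: eq_bigr => i _ /=.
  by rewrite exprMn mulrAC.
have := @monomial_prekopa F n alpha alpha_ge0 alpha_sum (I * J)%type S d
  (fun t A => (mn t)^-1 * a (r_ t) A) (fun A => omega F N / (om r * om c) * a r A).
rewrite laplaceE; under eq_bigr => t _ do rewrite laplaceE mulrC.
apply=> [t A|A|g g0].
- by rewrite mulr_ge0 // invr_ge0 ltW.
- by rewrite mulr_ge0 // ltW // divr_gt0 ?omega_gt0 // mulr_gt0.
rewrite coefE; under eq_bigr => t _ do rewrite coefE mulrC.
have := @table_coef_log_concave (fun t i j => w i j * g t (i, j)) _.
move=> /(_ (fun t i j => mulr_gt0 (w0 i j) (g0 t (i, j)))) /le_trans; apply.
rewrite ler_pM2l; last by rewrite divr_gt0 ?omega_gt0 // mulr_gt0.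
rewrite le_eqVlt; apply/orP; left; apply/eqP; congr table_coef.
apply/funext => i; apply/funext => j; rewrite mulr_sumr.
by apply: eq_bigr => t _; rewrite mulrCA.
Qed.

End Weighted.

(** * Bounded tables *)

(* A table bounded by K together with its complement to K is an (m + n) x (m * n) table
   with row sums (R, compl_col K C) and column sums K, supported on a pattern with two
   entries in each column. *)
Section Reduction.
Variables (m n : nat) (K : 'M[nat]_(m, n)).
Local Notation I := ('I_m + 'I_n)%type.
Local Notation J := ('I_m * 'I_n)%type.
Let B := (mxsum K).+1.
Local Notation table := {ffun J -> {ffun I -> 'I_B}}.

Definition pattern (x : I) (e : J) : bool :=
  match x with inl i => i == e.1 | inr j => j == e.2 end.

Definition on_pattern (A : table) :=
  [forall e, forall x, pattern x e || (A e x == 0%N :> nat)].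

Definition row_sums (R : 'rV[nat]_m) (C : 'rV[nat]_n) (x : I) : nat :=
  match x with inl i => R 0 i | inr j => compl_col K C 0 j end.

Definition col_sums (e : J) : nat := K e.1 e.2.

Lemma entry_le_mxsum i j : (K i j <= mxsum K)%N.
Proof. by rewrite /mxsum (bigD1 i) //= (bigD1 j) //= -addnA leq_addr. Qed.

Lemma sum_pattern (g : I -> nat) (e : J) : (forall x, ~~ pattern x e -> g x = 0%N) ->
  (\sum_x g x = g (inl e.1) + g (inr e.2))%N.
Proof.
move=> g0; rewrite big_sumType /=; congr (_ + _)%N.
  by rewrite (bigD1 e.1) //= big1 ?addn0 // => i ie; apply: g0.
by rewrite (bigD1 e.2) //= big1 ?addn0 // => j je; apply: g0.
Qed.

Lemma sum_pattern_inl (g : J -> nat) i : (forall e, ~~ pattern (inl i) e -> g e = 0%N) ->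
  (\sum_e g e = \sum_j g (i, j))%N.
Proof.
move=> g0; rewrite (eq_bigr (fun e => g (e.1, e.2))) => [|[] //].
rewrite -(pair_bigA _ (fun a b => g (a, b))) /= (bigD1 i) //=.
rewrite [X in (_ + X)%N]big1 ?addn0 // => a ai; apply: big1 => j _; apply: g0.
by rewrite /= eq_sym.
Qed.

Lemma sum_pattern_inr (g : J -> nat) j : (forall e, ~~ pattern (inr j) e -> g e = 0%N) ->
  (\sum_e g e = \sum_i g (i, j))%N.
Proof.
move=> g0; rewrite (eq_bigr (fun e => g (e.1, e.2))) => [|[] //].
rewrite -(pair_bigA _ (fun a b => g (a, b))) /=; apply: eq_bigr => i _.
rewrite (bigD1 j) //= big1 ?addn0 // => b bj; apply: g0.
by rewrite /= eq_sym.
Qed.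

Lemma T_card (R : 'rV[nat]_m) (C : 'rV[nat]_n) : (forall j, (C 0%R j <= \sum_i K i j)%N) ->
  T K R C = #|[pred A : table | [&& has_rows (row_sums R C) A,
                                    has_cols col_sums A & on_pattern A]]|.
Proof.
move=> CK; set X := [pred A | _].
pose h (A : table) : 'M[nat]_(m, n) := \matrix_(i, j) (A (i, j) (inl i) : nat).
have off (A : table) : on_pattern A -> forall e x, ~~ pattern x e -> A e x = 0%N :> nat.
  by move=> /forallP H e x /negPf px; have /forallP/(_ x) := H e; rewrite px => /eqP.
have colE (A : table) e : has_cols col_sums A -> on_pattern A ->
    (A e (inl e.1) + A e (inr e.2) = K e.1 e.2)%N.
  move=> /forallP/(_ e)/eqP HA /off pA.
  by rewrite -(sum_pattern (fun x => pA e x)).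
have h_inj : {in X &, injective h}.
  move=> A1 A2 /and3P[_ c1 p1] /and3P[_ c2 p2] /matrixP h12.
  have E1 e : A1 e (inl e.1) = A2 e (inl e.1) :> nat.
    by have := h12 e.1 e.2; rewrite !mxE -surjective_pairing.
  have E2 e : A1 e (inr e.2) = A2 e (inr e.2) :> nat.
    by have := colE A1 e c1 p1; rewrite -(colE A2 e c2 p2) E1 => /addnI.
  apply/ffunP => e; apply/ffunP => x; apply/val_inj => /=.
  have [|px] := boolP (pattern x e); last by rewrite !off.
  by case: x => [i|j] /eqP ->.
rewrite /T cardE -(size_map h); apply: perm_size; apply: uniq_perm.
- exact: fset_uniq.
- by rewrite map_inj_in_uniq ?enum_uniq // => A1 A2; rewrite !mem_enum; exact: h_inj.
move=> M; have -> : (M \in fset_set (tables K R C)) = (M \in tables K R C).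
  by rewrite in_fset_set //; exact: finite_tables.
apply/idP/mapP => [|[A]].
  rewrite inE => -[rM cM bM].
  pose A : table := [ffun e => [ffun x => inord (if pattern x e then
    (if x is inl _ then M e.1 e.2 else K e.1 e.2 - M e.1 e.2)%N else 0%N)]].
  have AE e x : A e x = (if pattern x e then
    (if x is inl _ then M e.1 e.2 else K e.1 e.2 - M e.1 e.2)%N else 0%N) :> nat.
    rewrite !ffunE inordK // ltnS.
    have KB := entry_le_mxsum e.1 e.2.
    case: ifP => // _; case: x => _; first exact: leq_trans (bM _ _) KB.
    exact: leq_trans (leq_subr _ _) KB.
  have pA : on_pattern A.
    by apply/forallP => e; apply/forallP => x; rewrite AE; case: ifP.
  exists A; last by apply/matrixP => i j; rewrite mxE AE /= eqxx.
  rewrite mem_enum inE pA andbT; apply/andP; split; apply/forallP; [move=> x|move=> e]; apply/eqP.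
    case: x => [i|j].
      rewrite (sum_pattern_inl (fun e => off A pA e (inl i))) /= -rM.
      by apply: eq_bigr => j _; rewrite AE /= eqxx.
    rewrite (sum_pattern_inr (fun e => off A pA e (inr j))) /= mxE -cM.
    rewrite -sumnB => [|i _]; last exact: bM.
    by apply: eq_bigr => i _; rewrite AE /= eqxx.
  by rewrite (sum_pattern (fun x => off A pA e x)) !AE /= !eqxx subnKC.
rewrite mem_enum => /and3P[/forallP rA cA pA] ->.
have bA i j : (A (i, j) (inl i) <= K i j)%N.
  by rewrite -(colE A (i, j) cA pA) leq_addr.
rewrite inE; split=> [i|j|i j].
- have /eqP := rA (inl i); rewrite (sum_pattern_inl (fun e => off A pA e (inl i))) /= => <-.
  by apply: eq_bigr => j _; rewrite mxE.
- have /eqP := rA (inr j); rewrite (sum_pattern_inr (fun e => off A pA e (inr j))) /= mxE.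
  have : (\sum_i (A (i, j) (inl i) + A (i, j) (inr j)) = \sum_i K i j)%N.
    by apply: eq_bigr => i _; rewrite (colE A (i, j)).
  have -> : (\sum_i h A i j = \sum_i A (i, j) (inl i))%N.
    by apply: eq_bigr => i _; rewrite mxE.
  have arith a b k c : (c <= k -> a + b = k -> b = k - c -> a = c)%N by lia.
  by rewrite big_split; exact: arith (CK j).
- by rewrite mxE.
Qed.

Section Perturbed.
Variables (F : realType) (eps : F).
Hypothesis eps01 : 0 < eps <= 1.

Definition pattern_wt (x : I) (e : J) : F := if pattern x e then 1 else eps.

Let wt (A : table) : F := \prod_e \prod_x pattern_wt x e ^+ A e x.

Let wt_ge0 A : 0 <= wt A.
Proof.
have /andP[e0 _] := eps01; apply: prodr_ge0 => e _; apply: prodr_ge0 => x _.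
by rewrite exprn_ge0 // /pattern_wt; case: ifP => // _; exact: ltW.
Qed.

Lemma wt_on_pattern A : on_pattern A -> wt A = 1.
Proof.
move=> /forallP pA; apply: big1 => e _; apply: big1 => x _.
rewrite /pattern_wt; case: ifP => px; first by rewrite expr1n.
by have /forallP/(_ x) := pA e; rewrite px /= => /eqP ->; rewrite expr0.
Qed.

Lemma wt_off_pattern A : ~~ on_pattern A -> wt A <= eps.
Proof.
have /andP[e0 e1] := eps01.
have prod01 (T : finType) (P : pred T) (f : T -> F) :
    (forall i, 0 <= f i <= 1) -> 0 <= \prod_(i | P i) f i <= 1.
  move=> f01; elim/big_ind: _ => [|u v /andP[u0 u1] /andP[v0 v1]|i _]; last exact: f01.
    by rewrite ler01 lexx.
  by rewrite mulr_ge0 ?mulr_ile1.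
have le1 x e k : 0 <= pattern_wt x e ^+ k <= 1.
  have w0 : 0 <= pattern_wt x e by rewrite /pattern_wt; case: ifP => // _; exact: ltW.
  have w1 : pattern_wt x e <= 1 by rewrite /pattern_wt; case: ifP.
  by rewrite exprn_ge0 ?exprn_ile1.
move=> /forallPn[e /forallPn[x]]; rewrite negb_or => /andP[/negPf px Ax].
rewrite /wt (bigD1 e) //= (bigD1 x) //= -mulrA -[leRHS]mulr1.
set u := \prod_(y | y != x) _; set v := \prod_(y | y != e) _.
have /andP[u0 u1] : 0 <= u <= 1 by apply: prod01 => y; exact: le1.
have /andP[v0 v1] : 0 <= v <= 1 by apply: (prod01) => y; apply: (prod01) => z; exact: le1.
have /andP[w0 _] := le1 x e (A e x).
apply: ler_pM; rewrite ?mulr_ge0 ?mulr_ile1 //.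
rewrite /pattern_wt px; case: (nat_of_ord _) Ax => // k _.
by rewrite exprS ler_piMr ?(ltW e0) // exprn_ile1 // ltW.
Qed.

Variables (R : 'rV[nat]_m) (C : 'rV[nat]_n).
Hypothesis CK : forall j, (C 0%R j <= \sum_i K i j)%N.

Let tsum := table_sum B pattern_wt (row_sums R C) col_sums.

Lemma T_le_table_sum : (T K R C)%:R <= tsum.
Proof.
rewrite T_card // -sum1_card natr_sum /tsum /table_sum [leLHS]big_mkcond [leRHS]big_mkcond.
apply: ler_sum => A _; rewrite inE; case: (has_rows _ A) => //=.
case: (has_cols _ A) => //=; case: ifP => [/wt_on_pattern|_]; last exact: wt_ge0.
by rewrite /wt => ->.
Qed.

Lemma table_sum_le_T : tsum <= (T K R C)%:R + eps * #|{: table}|%:R.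
Proof.
rewrite T_card // -sum1_card natr_sum -[#|{: table}|]sum1_card natr_sum mulr_sumr.
rewrite /tsum /table_sum [leLHS]big_mkcond [X in _ <= X + _]big_mkcond /= -big_split /=.
have /andP[e0 e1] := eps01.
apply: ler_sum => A _; rewrite inE mulr1; case: (has_rows _ A); rewrite /= ?add0r ?(ltW e0) //.
case: (has_cols _ A); rewrite /= ?add0r ?(ltW e0) //.
case: ifP => [/wt_on_pattern|/negbT/wt_off_pattern]; rewrite /wt ?add0r // => ->.
by rewrite lerDl ltW.
Qed.

End Perturbed.

Lemma Omega_row_sums (F : realType) R C :
  \prod_x omega F (row_sums R C x) = Omega F R * Omega F (compl_col K C).
Proof. by rewrite big_sumType /Omega !big_ord1. Qed.

Lemma Omega_col_sums (F : realType) : \prod_e omega F (col_sums e) = Omega F K.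
Proof. by rewrite /Omega pair_bigA. Qed.

Lemma sum_col_sums : (\sum_e col_sums e = mxsum K)%N.
Proof. by rewrite /mxsum pair_bigA. Qed.

Lemma sum_row_sums (R : 'rV[nat]_m) (C : 'rV[nat]_n) :
  (forall j, (C 0%R j <= \sum_i K i j)%N) -> mxsum R = mxsum C ->
  (\sum_x row_sums R C x = mxsum K)%N.
Proof.
move=> CK RC; rewrite big_sumType /=.
have -> : (\sum_i R 0%R i = \sum_j C 0%R j)%N by move: RC; rewrite /mxsum !big_ord1.
rewrite /mxsum exchange_big -big_split; apply: eq_bigr => j _ /=.
by rewrite mxE subnKC.
Qed.

End Reduction.

Theorem theorem1 (F : realType) (m n p N : nat)
  (hm : (1 <= m)%N) (hn : (1 <= n)%N) (hp : (1 <= p)%N)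
  (alpha : 'I_p -> F)
  (alpha_ge0 : forall t, 0 <= alpha t)
  (alpha_sum : \sum_t alpha t = 1)
  (Rs : 'I_p -> 'rV[nat]_m) (Cs : 'I_p -> 'rV[nat]_n)
  (hRs : forall t, mxsum (Rs t) = N)
  (hCs : forall t, mxsum (Cs t) = N)
  (K : 'M[nat]_(m, n))
  (hCK : forall t j, (Cs t 0%R j <= \sum_i K i j)%N)
  (R : 'rV[nat]_m) (C : 'rV[nat]_n)
  (hR : forall i, (R 0 i)%:R = \sum_t alpha t * (Rs t 0 i)%:R)
  (hC : forall j, (C 0 j)%:R = \sum_t alpha t * (Cs t 0 j)%:R) :
  omega F (mxsum K) * (T K R C)%:R
    / (Omega F R * Omega F (compl_col K C) * Omega F K)
  >= \prod_t
       ((T K (Rs t) (Cs t))%:R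
          / Num.min (Omega F (Rs t) * Omega F (compl_col K (Cs t)))
                    (Omega F K)) `^ alpha t.
Proof.
have CK j : (C 0%R j <= \sum_i K i j)%N.
  rewrite -(ler_nat F) hC (_ : (\sum_i K i j)%:R = \sum_t alpha t * (\sum_i K i j)%:R).
    apply: ler_sum => t _.
    by rewrite ler_wpM2l // ler_nat.
  by rewrite -mulr_suml alpha_sum mul1r.
pose i0 : 'I_m + 'I_n := inl (Ordinal hm).
have sum_t t := sum_row_sums (hCK t) (etrans (hRs t) (esym (hCs t))).
have r_lt t x : (row_sums K (Rs t) (Cs t) x < (mxsum K).+1)%N.
  by rewrite ltnS -(sum_t t) (bigD1 x) //= leq_addr.
have c_lt e : (col_sums K e < (mxsum K).+1)%N by rewrite ltnS entry_le_mxsum.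
have sum_rc t : (\sum_x row_sums K (Rs t) (Cs t) x = \sum_e col_sums K e)%N.
  by rewrite sum_t sum_col_sums.
have rE x : (row_sums K R C x)%:R =
    \sum_t alpha t * (row_sums K (Rs t) (Cs t) x)%:R.
  case: x => [i|j] //=; rewrite mxE natrB // hC.
  under [RHS]eq_bigr do rewrite mxE natrB // mulrBr.
  by rewrite sumrB -mulr_suml alpha_sum mul1r.
have main eps (eps01 : 0 < eps <= 1) := table_sum_ineq alpha_ge0 alpha_sum i0 r_lt c_lt
  sum_rc rE (w := pattern_wt eps).
set X := \prod_t _.
set a := omega F (mxsum K) / (Omega F R * Omega F (compl_col K C) * Omega F K).
have om_gt0 u v (M : 'M[nat]_(u, v)) : 0 < Omega F M.
  by apply: prodr_gt0 => i _; apply: prodr_gt0 => j _; exact: omega_gt0.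
have a0 : 0 < a.
  by apply: divr_gt0; [exact: omega_gt0|rewrite !mulr_gt0].
pose M : F := #|{: {ffun 'I_m * 'I_n -> {ffun 'I_m + 'I_n -> 'I_(mxsum K).+1}}}|%:R.
have bound eps : 0 < eps <= 1 -> X <= a * ((T K R C)%:R + eps * M).
  move=> eps01; have /andP[e0 e1] := eps01.
  have := main eps eps01.
  rewrite !Omega_row_sums !Omega_col_sums sum_col_sums => H.
  apply: le_trans (le_trans (H _) _) => [|x e|].
  - apply: ler_prod => t _; rewrite powR_ge0 /= Omega_row_sums.
    have mn0 : 0 < Num.min (Omega F (Rs t) * Omega F (compl_col K (Cs t))) (Omega F K).
      by rewrite lt_min mulr_gt0 // om_gt0.
    have TS := T_le_table_sum eps01 (Rs t) (hCK t).
    apply: ge0_ler_powR; rewrite ?nnegrE ?divr_ge0 ?(ltW mn0) //.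
      exact: le_trans TS.
    by rewrite ler_pM2r // invr_gt0.
  - by rewrite /pattern_wt; case: ifP.
  - by rewrite ler_pM2l // table_sum_le_T.
rewrite mulrAC -/a; apply/ler_addgt0Pr => e e0.
have M0 : 0 <= M by [].
have d0 : 0 < a * M + 1 by rewrite ltr_wpDl // mulr_ge0 // ltW.
pose eps := Num.min 1 (e / (a * M + 1)).
have eps0 : 0 < eps by rewrite lt_min ltr01 divr_gt0.
have eps01 : 0 < eps <= 1 by rewrite eps0 /eps ge_min lexx.
apply: le_trans (bound _ eps01) _; rewrite mulrDr lerD2l mulrCA.
have le_e : eps * (a * M + 1) <= e by rewrite -ler_pdivlMr // ge_min lexx orbT.
by apply: le_trans le_e; rewrite ler_pM2l // lerDl.
Qed.
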